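(* Let $2\le a\le n$. For the hook $\lambda=\{1^{n-a},a\}$, the special ED degree of the variety $\Delta_\lambda$ is $n$, independently of $a$, whereas the generic ED degree of $\Delta_\lambda$ equals $(2a-1)n-2(a-1)^2$.
   Context: $\Delta_\lambda$, for $\lambda=\{1^{n-a},a\}$ (the partition of $n$ with one part $a$ and $n-a$ parts equal to $1$), is the variety of binary forms of degree $n$ having a root of multiplicity at least $a$. Forms are written $f=\sum_{i=0}^n\binom ni a_ix^iy^{n-i}$. Given a nondegenerate quadratic form $\langle\cdot,\cdot\rangle$ (real positive definite, extended to $\mathbb{C}$) on the space of binary forms of degree $n$, the ED degree of $\Delta_\lambda$ is the number of complex critical points, for generic $h$, of the function $f\mapsto\langle f-h,f-h\rangle$ on the smooth locus of the affine cone over $\Delta_\lambda$. The special ED degree is the ED degree for the inner product $\langle f,g\rangle=\sum_{i=0}^n\binom ni a_ib_i$, where $f=\sum\binom ni a_ix^iy^{n-i}$ and $g=\sum\binom ni b_ix^iy^{n-i}$. The generic ED degree is the ED degree for a generic positive definite quadratic form. *)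

(* Defs.v *)
From HB Require Import structures.
From mathcomp Require Import all_boot all_order all_algebra.
From mathcomp Require Import reals complex mpoly.

Set Implicit Arguments.
Unset Strict Implicit.
Unset Printing Implicit Defensive.

Import Order.TTheory GRing.Theory Num.Theory.
Local Open Scope ring_scope.

(* Points of affine m-space are row vectors p, and F.@[p 0] is the value of    *)
(* the polynomial F at the point p.                                            *)
Section AffineVarieties.
Variables (K : fieldType) (m : nat).
Implicit Types (X P : 'rV[K]_m -> Prop) (F : {mpoly K[m]}) (p v : 'rV[K]_m).

(* P holds on a nonempty relatively Zariski-open subset of X. For X Zariski    *)
(* dense in an irreducible variety this is "P holds for generic p in X".       *)
Definition generic_in X P : Prop :=
  exists F, (exists p, X p /\ F.@[p 0] != 0) /\
            (forall p, X p -> F.@[p 0] != 0 -> P p).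

Definition vanishes_on X F : Prop := forall p, X p -> F.@[p 0] = 0.

(* The classes of f_0, ..., f_(r-1) in the coordinate ring of X are            *)
(* algebraically independent over K.                                           *)
Definition alg_independent_on X r (f : 'I_r -> {mpoly K[m]}) : Prop :=
  forall G : {mpoly K[r]},
    (forall p, X p -> G.@[fun i => (f i).@[p 0]] = 0) -> G = 0.

(* The dimension of an irreducible affine variety X, as the transcendence      *)
(* degree of its coordinate ring.                                              *)
Definition has_dimension X d : Prop :=
  (exists f : 'I_d -> {mpoly K[m]}, alg_independent_on X f) /\
  ~ (exists f : 'I_d.+1 -> {mpoly K[m]}, alg_independent_on X f).

Definition differential F p v : K := \sum_(i < m) (F^`M(i)).@[p 0] * v 0 i.

(* Zariski tangent space, defined by the full vanishing ideal of X. *)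
Definition tangent X p v : Prop :=
  forall F, vanishes_on X F -> differential F p v = 0.

Definition smooth_point X p : Prop :=
  X p /\ exists T : {vspace 'rV[K]_m},
    (forall v, v \in T <-> tangent X p v) /\ has_dimension X (\dim T).

Definition critical_point X F p : Prop :=
  smooth_point X p /\ (forall v, tangent X p v -> differential F p v = 0).

End AffineVarieties.

Definition bilin (A : comNzRingType) m (Q : 'M[A]_m) (u v : 'rV[A]_m) : A :=
  (u *m Q *m v^T) 0 0.

(* The polynomial function p |-> <p - h, p - h> on affine m-space. *)
Definition sqdist (K : fieldType) m (Q : 'M[K]_m) (h : 'rV[K]_m) :
    {mpoly K[m]} :=
  let w := \row_(i < m) ('X_i - (h 0 i)%:MP) in
  bilin (map_mx (@mpolyC m K) Q) w w.

(* N is the ED degree of the (irreducible) affine cone X, with respect to the  *)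
(* bilinear form with Gram matrix Q.                                           *)
Definition is_EDdegree (K : fieldType) m (Q : 'M[K]_m)
    (X : 'rV[K]_m -> Prop) (N : nat) : Prop :=
  generic_in (fun _ : 'rV[K]_m => True)
    (fun h => exists s : seq 'rV[K]_m,
       [/\ uniq s, size s = N
         & forall p, p \in s <-> critical_point X (sqdist Q h) p]).

Definition posdef (R : realType) m (Q : 'M[R]_m) : Prop :=
  Q^T = Q /\ forall v : 'rV[R]_m, v != 0 -> 0 < bilin Q v v.

Definition complexify (R : realType) m (Q : 'M[R]_m) : 'M[R[i]]_m :=
  map_mx (real_complex R) Q.

(* N is the ED degree of X for a generic positive definite quadratic form; the *)
(* positive definite matrices are Zariski dense among the symmetric ones.      *)
Definition is_generic_EDdegree (R : realType) m
    (X : 'rV[R[i]]_m -> Prop) (N : nat) : Prop :=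
  generic_in (fun q : 'rV[R]_(m * m) => posdef (vec_mx q))
    (fun q => is_EDdegree (complexify (vec_mx q)) X N).

(* The form with coordinates a_0, ..., a_n; the variables x, y are 'X_0, 'X_1. *)
Definition binary_form (K : fieldType) n (a : 'rV[K]_n.+1) : {mpoly K[2]} :=
  \sum_(i < n.+1) ('C(n, i)%:R * a 0 i) *:
    ('X_ord0 ^+ i * 'X_ord_max ^+ (n - i)).

(* Some point (s : t) of the projective line is a root of multiplicity at      *)
(* least k of the form f; this holds for f = 0.                                *)
Definition has_root_of_mult (K : fieldType) k (f : {mpoly K[2]}) : Prop :=
  exists s t : K, (s, t) != (0, 0) /\
    exists g : {mpoly K[2]}, f = (t *: 'X_ord0 - s *: 'X_ord_max) ^+ k * g.

(* The affine cone over Delta_lambda for the hook lambda = {1^(n-k), k}, in    *)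
(* the coordinates a_i.                                                        *)
Definition hook_cone (K : fieldType) n k (a : 'rV[K]_n.+1) : Prop :=
  has_root_of_mult k (binary_form a).

(* Gram matrix, in the coordinates a_i, of <f, g> = \sum_i 'C(n, i) a_i b_i. *)
Definition special_gram (R : realType) n : 'M[R]_n.+1 :=
  diag_mx (\row_(i < n.+1) 'C(n, i)%:R).

(* Main.v *)
From HB Require Import structures.
Require Import Defs.
From mathcomp Require Import all_boot all_order all_algebra.
From mathcomp Require Import boolp reals complex mpoly.
From mathcomp Require Import perm ring lra zify.

Set Implicit Arguments.
Unset Strict Implicit.
Unset Printing Implicit Defensive.

Import Order.TTheory GRing.Theory Num.Theory.
Local Open Scope ring_scope.

(** Write [k] for the multiplicity and put [y = 1], so that a form becomes a
    polynomial of degree at most [n] ([hat], with inverse [vec]).  With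
    [l = 'X - z], the cone is the closure of the chart
    [(z, g) |-> l ^+ k * g], where [g] has degree at most [n - k]; its tangent
    space at a generic point of the chart is
    [W_z = l ^+ k.-1 * {degree <= n - k + 1}], of dimension [n - k + 2].  Hence
    the critical points for [h] correspond to the pairs [(z, g)] for which
    [h - l ^+ k * g] is orthogonal to [W_z].  For fixed [z] these are
    [n - k + 2] linear equations in the [n - k + 1] coefficients of [g]: their
    solvability is one equation in [z], linear in [h], and the number of its
    roots is the ED degree.

    [EDdegree_criterion] turns this into a theorem about any family of
    polynomials [c_j] such that [\sum_j h_j * c_j(z) = 0] expresses the
    solvability, except at the roots of a polynomial [E].  Its genericity
    claims all rest on [hypersurface_image]: a polynomial self-map of affine
    space sends a proper hypersurface into a proper hypersurface.  It is
    applied to the parametrization [(z, g, w) |-> h] of all the triples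
    (critical point, target), where [w] parametrizes the normal space, and to
    the hypersurface where either the chart point fails to be a smooth point
    with tangent space [W_z], or the root [z] is multiple, or [E z = 0].

    For the special product, the orthogonal complement of [W_z] consists of the
    multiples of [m ^+ (n - k + 2)], where [m = 1 + z *: 'X] ([apolar]).  When
    [l] and [m] are coprime, that is [z ^+ 2 + 1 != 0], the equation says that
    [h] is orthogonal to [l ^+ k.-1 * m ^+ (n - k + 1)], which has degree [n]
    in [z], whatever [k] is: the special ED degree is [n].

    For a general form [Q], the equation is the vanishing of the determinant of
    the matrix with first row [Q(h, l ^+ k.-1 * 'X^j)] and other rows
    [Q(l ^+ k * 'X^i, l ^+ k.-1 * 'X^j)], with [i <= n - k] and
    [j <= n - k + 1].  Its degree in [z] is
    [(k - 1) + (n - k + 1) * (2 * k - 1) = (2 * k - 1) * n - 2 * (k - 1) ^ 2],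
    where for a suitable [h] the leading coefficient is a Gram determinant of
    the real form [Q].
    This determinant gives the ED degree if no [l ^+ k * g] is orthogonal to
    [W_z], which is a condition of codimension two on [Q] for each [z], hence
    of codimension one in total ([degenerate_forms]). *)

(** * Polynomial functions on affine space *)

Section NatPoint.
Variable K : numFieldType.

Lemma poly_nat_zero (A : idomainType) (p : {poly A}) :
  injective (fun a : nat => a%:R : A) ->
  (forall a : nat, p.[a%:R] = 0) -> p = 0.
Proof.
move=> inj p0; apply: (roots_geq_poly_eq0 (rs := [seq a%:R | a <- iota 0 (size p)])).
- by apply/allP => _ /mapP[a _ ->]; rewrite rootE p0.
- by rewrite map_inj_uniq ?iota_uniq.
by rewrite size_map size_iota.
Qed.

Lemma mmap_morph (m : nat) (A B : comNzRingType) (f : {rmorphism K -> A})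
    (phi : {rmorphism A -> B}) (h : 'I_m -> A) (p : {mpoly K[m]}) :
  phi (mmap f h p) = mmap (phi \o f) (phi \o h) p.
Proof.
rewrite /mmap rmorph_sum; apply: eq_bigr => mm _ /=.
rewrite rmorphM /mmap1 rmorph_prod; congr (_ * _).
by apply: eq_bigr => i _ /=; rewrite rmorphXn.
Qed.

Lemma natr_inj_mpoly m : injective (fun a : nat => a%:R : {mpoly K[m]}).
Proof.
move=> a b /eqP; rewrite -!mpolyC_nat mpolyC_eq => /eqP/eqP.
by rewrite eqr_nat => /eqP.
Qed.

(** Points with natural coordinates are already Zariski dense in characteristic
    zero: the variables are specialized one at a time, each time viewing the
    polynomial as a univariate one, with infinitely many roots. *)
Lemma mpoly_nat_zero m (G : {mpoly K[m]}) :
  (forall v : 'I_m -> nat, G.@[fun i => (v i)%:R] = 0) -> G = 0.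
Proof.
move=> G0.
have key (s : seq 'I_m) : uniq s -> forall v : 'I_m -> nat,
    mmap (@mpolyC m K) (fun i => if i \in s then 'X_i else (v i)%:R) G = 0.
  elim: s => [_ v | j s IHs /= /andP[js us] v].
    have := congr1 (@mpolyC m K) (G0 v).
    rewrite /meval mmap_morph mpolyC0 => <-; rewrite /mmap.
    apply: eq_bigr => mm _ /=; congr (_ * _); apply: eq_bigr => i _ /=.
    by rewrite mpolyC_nat.
  pose Gh := mmap (polyC \o @mpolyC m K)
     (fun i => if i == j then 'X else (if i \in s then 'X_i else (v i)%:R)%:P) G.
  have Gh0 : Gh = 0.
    apply: (poly_nat_zero (@natr_inj_mpoly m)) => a.
    rewrite -horner_evalE mmap_morph -[RHS](IHs us (fun i => if i == j then a else v i)).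
    rewrite /mmap; apply: eq_bigr => mm _ /=; rewrite horner_evalE hornerC.
    congr (_ * _); apply: eq_bigr => i _ /=; rewrite horner_evalE.
    by case: eqP => [->|]; rewrite ?(negPf js) !hornerE.
  have := congr1 (horner_eval 'X_j) Gh0; rewrite /= mmap_morph horner_evalE horner0.
  move=> <-; rewrite /mmap; apply: eq_bigr => mm _ /=; rewrite horner_evalE hornerC.
  congr (_ * _); apply: eq_bigr => i _ /=; rewrite horner_evalE in_cons.
  by case: eqP => [->|] /=; rewrite !hornerE.
rewrite -[LHS]comp_mpoly_id -[RHS](key _ (enum_uniq 'I_m) (fun=> 0%N)).
rewrite /comp_mpoly /mmap; apply: eq_bigr => mm _; congr (_ * _).
by apply: eq_bigr => i _; rewrite mem_enum inE tnth_mktuple.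
Qed.

Lemma mpoly_neq0_nat m (G : {mpoly K[m]}) : G != 0 ->
  exists v : 'I_m -> nat, G.@[fun i => (v i)%:R] != 0.
Proof.
move=> G0; apply: contrapT => /forallNP H; case/eqP: G0.
by apply: mpoly_nat_zero => v; have /negP := H v; rewrite negbK => /eqP.
Qed.

Lemma mpoly_neq0_point m (G : {mpoly K[m]}) : G != 0 ->
  exists v : 'rV[K]_m, G.@[v 0] != 0.
Proof.
move=> /mpoly_neq0_nat[v Gv]; exists (\row_i (v i)%:R).
by rewrite (meval_eq (v2 := fun i => (v i)%:R)) // => i; rewrite mxE.
Qed.

Lemma mpoly_zero_point m (G : {mpoly K[m]}) :
  (forall v : 'rV[K]_m, G.@[v 0] = 0) -> G = 0.
Proof.
by move=> G0; apply/eqP/negPn/negP => /mpoly_neq0_point[v]; rewrite G0 eqxx.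
Qed.

End NatPoint.

Section PolyFun.
Variable K : numFieldType.
Variable r : nat.
Implicit Types (f g : 'rV[K]_r -> K).

(** Polynomial functions are handled extensionally, through their values, so that
    parametrizations can be written as ordinary functions of matrices and
    univariate polynomials. *)
Definition polyfun f := exists F : {mpoly K[r]}, forall x, f x = F.@[x 0].

Lemma polyfun_ext f g : f =1 g -> polyfun f -> polyfun g.
Proof. by move=> fg [F fF]; exists F => x; rewrite -fg. Qed.

Lemma polyfunC c : polyfun (fun=> c).
Proof. by exists c%:MP => x; rewrite mevalC. Qed.

Lemma polyfunX i : polyfun (fun x => x 0 i).
Proof. by exists 'X_i => x; rewrite mevalXU. Qed.

Lemma polyfunD f g : polyfun f -> polyfun g -> polyfun (fun x => f x + g x).
Proof. by move=> [F fF] [G gG]; exists (F + G) => x; rewrite mevalD fF gG. Qed.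

Lemma polyfunM f g : polyfun f -> polyfun g -> polyfun (fun x => f x * g x).
Proof. by move=> [F fF] [G gG]; exists (F * G) => x; rewrite mevalM fF gG. Qed.

Lemma polyfunN f : polyfun f -> polyfun (fun x => - f x).
Proof. by move=> [F fF]; exists (- F) => x; rewrite mevalN fF. Qed.

Lemma polyfunB f g : polyfun f -> polyfun g -> polyfun (fun x => f x - g x).
Proof. by move=> hf hg; apply: polyfunD hf (polyfunN hg). Qed.

Lemma polyfunXn f k : polyfun f -> polyfun (fun x => f x ^+ k).
Proof. by move=> [F fF]; exists (F ^+ k) => x; rewrite rmorphXn /= fF. Qed.

Lemma polyfun_sum (I : Type) (s : seq I) (P : pred I) (F : I -> 'rV[K]_r -> K) :
  (forall i, polyfun (F i)) -> polyfun (fun x => \sum_(i <- s | P i) F i x).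
Proof.
move=> FP; elim: s => [|i s IHs].
  by apply: polyfun_ext (polyfunC 0) => x; rewrite big_nil.
apply: polyfun_ext (_ : polyfun (fun x => (if P i then F i x else 0) +
                                    \sum_(i <- s | P i) F i x)).
  by move=> x; rewrite big_cons; case: (P i); rewrite ?add0r.
by apply: polyfunD => //; case: (P i) => //; exact: polyfunC.
Qed.

Lemma polyfun_prod (I : Type) (s : seq I) (P : pred I) (F : I -> 'rV[K]_r -> K) :
  (forall i, polyfun (F i)) -> polyfun (fun x => \prod_(i <- s | P i) F i x).
Proof.
move=> FP; elim: s => [|i s IHs].
  by apply: polyfun_ext (polyfunC 1) => x; rewrite big_nil.
apply: polyfun_ext (_ : polyfun (fun x => (if P i then F i x else 1) *
                                    \prod_(i <- s | P i) F i x)).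
  by move=> x; rewrite big_cons; case: (P i); rewrite ?mul1r.
by apply: polyfunM => //; case: (P i) => //; exact: polyfunC.
Qed.

Lemma polyfun_meval m (h : 'rV[K]_r -> 'I_m -> K) (F : {mpoly K[m]}) :
  (forall i, polyfun (h^~ i)) -> polyfun (fun x => F.@[h x]).
Proof.
move=> hP; apply: polyfun_ext
  (_ : polyfun (fun x => \sum_(mm <- msupp F) F@_mm * \prod_i h x i ^+ mm i)).
  by move=> x; rewrite mevalE.
apply: polyfun_sum => mm; apply: polyfunM; first exact: polyfunC.
by apply: polyfun_prod => i; apply: polyfunXn.
Qed.

Lemma polyfun_horner (p : {poly K}) f : polyfun f -> polyfun (fun x => p.[f x]).
Proof.
move=> fP; apply: polyfun_ext (_ : polyfun (fun x => \sum_(i < size p) p`_i * f x ^+ i)).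
  by move=> x; rewrite horner_coef.
by apply: polyfun_sum => i; apply: polyfunM; [exact: polyfunC | exact: polyfunXn].
Qed.

Lemma polyfun_neq0M f g : polyfun f -> polyfun g ->
  (exists x, f x != 0) -> (exists x, g x != 0) -> exists x, f x * g x != 0.
Proof.
move=> [F fF] [G gG] [x fx] [y gy].
have F0 : F != 0 by apply: contraNneq fx => F0; rewrite fF F0 meval0.
have G0 : G != 0 by apply: contraNneq gy => G0; rewrite gG G0 meval0.
have [v Hv] := mpoly_neq0_point (mulf_neq0 F0 G0).
by exists v; rewrite fF gG -mevalM.
Qed.

Lemma polyfun_neq0_prod (I : Type) (s : seq I) (F : I -> 'rV[K]_r -> K) :
  (forall i, polyfun (F i)) -> (forall i, exists x, F i x != 0) ->
  exists x, \prod_(i <- s) F i x != 0.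
Proof.
move=> FP F0; elim: s => [|i s IHs].
  by exists 0; rewrite big_nil oner_eq0.
have [x] := polyfun_neq0M (FP i) (polyfun_prod s xpredT FP) (F0 i) IHs.
by exists x; rewrite big_cons.
Qed.

(** The polynomial ring is a domain, so two nonempty open sets meet.  With a single
    variable, this is how limits are taken below. *)
Lemma polyfun_dense f b : polyfun f -> polyfun b -> (exists x, b x != 0) ->
  (forall x, b x != 0 -> f x = 0) -> forall x, f x = 0.
Proof.
move=> fP bP b0 H; apply: contrapT => /existsNP[x /eqP fx].
have [y] := polyfun_neq0M fP bP (ex_intro _ x fx) b0.
by have [->|/H ->] := eqVneq (b y) 0; rewrite ?mulr0 ?mul0r eqxx.
Qed.

Definition ppolyfun (p : 'rV[K]_r -> {poly K}) := forall i, polyfun (fun x => (p x)`_i).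

Lemma ppolyfun_ext p q : p =1 q -> ppolyfun p -> ppolyfun q.
Proof. by move=> pq pP i; apply: polyfun_ext (pP i) => x; rewrite pq. Qed.

Lemma ppolyfunK (p : {poly K}) : ppolyfun (fun=> p).
Proof. by move=> i; exact: polyfunC. Qed.

Lemma ppolyfunC f : polyfun f -> ppolyfun (fun x => (f x)%:P).
Proof.
move=> fP i; apply: (@polyfun_ext (fun x => if i == 0%N then f x else 0)).
  by move=> x; rewrite coefC.
by case: (i == 0%N) => //; exact: polyfunC.
Qed.

Lemma ppolyfunD p q : ppolyfun p -> ppolyfun q -> ppolyfun (fun x => p x + q x).
Proof.
by move=> pP qP i; apply: polyfun_ext (polyfunD (pP i) (qP i)) => x; rewrite coefD.
Qed.

Lemma ppolyfunN p : ppolyfun p -> ppolyfun (fun x => - p x).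
Proof. by move=> pP i; apply: polyfun_ext (polyfunN (pP i)) => x; rewrite coefN. Qed.

Lemma ppolyfunM p q : ppolyfun p -> ppolyfun q -> ppolyfun (fun x => p x * q x).
Proof.
move=> pP qP i.
apply: (@polyfun_ext (fun x => \sum_(j < i.+1) (p x)`_j * (q x)`_(i - j))).
  by move=> x; rewrite coefM.
by apply: polyfun_sum => j; apply: polyfunM.
Qed.

Lemma ppolyfunXn p k : ppolyfun p -> ppolyfun (fun x => p x ^+ k).
Proof.
move=> pP; elim: k => [|k IHk]; first exact: ppolyfunK.
by apply: ppolyfun_ext (ppolyfunM pP IHk) => x; rewrite exprS.
Qed.

End PolyFun.

(** * Images of hypersurfaces are not dense *)

Section Dominance.
Variable K : numFieldType.

(** There are at most [M ^ r] monomials of degree less than [M] in [r] variables. *)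
Lemma mpoly_lin_dep r (T : finType) (e : T -> {mpoly K[r]}) (M : nat) :
  (forall t, (msize (e t) <= M)%N) -> (M ^ r < #|T|)%N ->
  exists c : T -> K, (exists t, c t != 0) /\ \sum_t c t *: e t = 0.
Proof.
move=> eM cT.
pose mon (f : {ffun 'I_r -> 'I_M}) : 'X_{1..r} := [multinom (f i : nat) | i < r].
pose A : 'M[K]_(#|T|, #|{ffun 'I_r -> 'I_M}|) :=
  \matrix_(t, j) (e (enum_val t))@_(mon (enum_val j)).
have rA : (\rank A < #|T|)%N.
  by apply: leq_ltn_trans (rank_leq_col A) _; rewrite card_ffun !card_ord.
have /rowV0Pn[v /sub_kermxP vA v0] : kermx A != 0.
  by rewrite kermx_eq0 /row_free neq_ltn rA.
have [j vj] : exists j, v 0 j != 0 by apply/rV0Pn.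
exists (fun t => v 0 (enum_rank t)); split; first by exists (enum_val j); rewrite enum_valK.
apply/mpolyP => m; rewrite mcoeff0 raddf_sum /=.
have [mM|mM] := leqP M (mdeg m).
  rewrite big1 // => t _; rewrite mcoeffZ memN_msupp_eq0 ?mulr0 //.
  by apply: msize_mdeg_ge; apply: leq_trans (eM t) mM.
have mi i : (m i < M)%N.
  by apply: leq_ltn_trans mM; rewrite mdegE (bigD1 i) //= leq_addr.
have mE : m = mon [ffun i => Ordinal (mi i)].
  by apply/mnmP => i; rewrite mnmE ffunE.
have := congr1 (fun B : 'rV_#|{ffun 'I_r -> 'I_M}| => B 0 (enum_rank [ffun i => Ordinal (mi i)])) vA.
rewrite /= !mxE => {2}<-; rewrite (reindex (@enum_val T predT)) /=; last first.
  by exists enum_rank => t _; rewrite ?enum_valK ?enum_rankK.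
by apply: eq_bigr => t _; rewrite mcoeffZ enum_valK !mxE enum_rankK -mE.
Qed.

Lemma msizeXn_le r (p : {mpoly K[r]}) D k : (msize p <= D)%N ->
  (msize (p ^+ k) <= k * D.+1 + 1)%N.
Proof.
move=> pD; elim: k => [|k IHk]; first by rewrite msize1.
rewrite exprS; apply: leq_trans (msizeM_le _ _) _.
by lia.
Qed.

Lemma msize_prod_le r (I : Type) (s : seq I) (F : I -> {mpoly K[r]}) D :
  (forall i, (msize (F i) <= D)%N) ->
  (msize (\prod_(i <- s) F i) <= size s * D.+1 + 1)%N.
Proof.
move=> FD; elim: s => [|i s IHs]; first by rewrite big_nil msize1.
rewrite big_cons /=; apply: leq_trans (msizeM_le _ _) _.
have := FD i; move: IHs; rewrite mulSn; move: (msize (F i)) (msize _) (size s * D.+1)%N => X Y Z h1 h2.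
lia.
Qed.

(** The products of powers of [f_1, .., f_r, b] with exponents less than [N] number
    [N ^ r.+1], and have degree [O(N)], so they span a space of dimension
    [O(N ^ r)]: for large [N] there is a relation
    [\sum_s P_s(f) * b ^+ s = 0].  For the least [s] with [P_s != 0], dividing by
    [b ^+ s] leaves [P_s(f) + b * (..) = 0], so that [F := P_s] works. *)
Lemma hypersurface_dep r (f : 'I_r -> {mpoly K[r]}) (b : {mpoly K[r]}) : b != 0 ->
  exists F : {mpoly K[r]}, F != 0 /\
    forall x : 'rV_r, b.@[x 0] = 0 -> F.@[fun i => (f i).@[x 0]] = 0.
Proof.
move=> b0.
pose D := (msize b + \sum_i msize (f i))%N.
have bD : (msize b <= D)%N by rewrite leq_addr.
have fD i : (msize (f i) <= D)%N.
  by rewrite /D (bigD1 i) //=; lia.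
(* The products have degree less than [N * C], and [(N * C) ^ r < N ^ r.+1]. *)
pose C := (r.+1 * (D + 4))%N; pose N := (C ^ r).+1.
pose T := ({ffun 'I_r -> 'I_N} * 'I_N)%type.
pose e (t : T) := (\prod_(i < r) f i ^+ t.1 i) * b ^+ t.2.
have eM t : (msize (e t) <= N * C)%N.
  have h1 : (msize (b ^+ t.2) <= N * D.+1 + 1)%N.
    apply: leq_trans (msizeXn_le _ bD) _; have := ltn_ord t.2.
    by move=> h; rewrite leq_add2r leq_mul2r (ltnW h) orbT.
  have h2 : (msize (\prod_(i < r) f i ^+ t.1 i) <= r * (N * D.+1 + 1).+1 + 1)%N.
    apply: leq_trans (msize_prod_le _ (D := N * D.+1 + 1) _) _; last first.
      by rewrite /index_enum -enumT size_enum_ord.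
    move=> i; apply: leq_trans (msizeXn_le _ (fD i)) _.
    by rewrite leq_add2r leq_mul2r (ltnW (ltn_ord _)) orbT.
  apply: leq_trans (msizeM_le _ _) _.
  apply: leq_trans (_ : _ <= (r * (N * D.+1 + 1).+1 + 1 + (N * D.+1 + 1)).+1)%N _.
    by rewrite ltnS leq_add.
  rewrite /C.
  move: (C ^ r)%N @N {e T h1 h2 t} => c N; nia.
have [||c [[t0 ct0] cE]] := @mpoly_lin_dep r T e (N * C).
- exact: eM.
- rewrite card_prod card_ffun !card_ord expnMn ltn_mul2l expn_gt0 /=.
  exact: ltnSn.
pose P s := \sum_(a : {ffun 'I_r -> 'I_N}) c (a, s) *: 'X_[ [multinom (a i : nat) | i < r] ].
have Pc (a : {ffun 'I_r -> 'I_N}) s : (P s)@_[multinom (a i : nat) | i < r] = c (a, s).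
  rewrite /P raddf_sum (bigD1 a) //= mcoeffZ mcoeffX eqxx mulr1 big1 ?addr0 // => a' aa'.
  rewrite mcoeffZ mcoeffX; case: eqP => [/mnmP H|]; rewrite ?mulr0 //.
  case/eqP: aa'; apply/ffunP => i; have := H i; rewrite !mnmE => Hi; exact: val_inj.
have [s Ps smin] : exists2 s : 'I_N, P s != 0 & forall s', (s' < s)%N -> P (inord s') = 0.
  have Ps0 : P t0.2 != 0.
    apply: contraNneq ct0 => P0; have := Pc t0.1 t0.2; rewrite P0 mcoeff0.
    by case: (t0) => ? ? /= <-.
  case: (@arg_minnP _ t0.2 (fun s => P s != 0) (fun s : 'I_N => s : nat) Ps0) => s Ps smin.
  exists s => // s' s's; apply/eqP/negPn/negP => /smin; rewrite inordK; first by lia.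
  by apply: ltn_trans s's _.
pose ev (p : {mpoly K[r]}) := mmap (@mpolyC r K) f p.
have evP s' : ev (P s') = \sum_(a : {ffun 'I_r -> 'I_N}) c (a, s') *: \prod_(i < r) f i ^+ a i.
  rewrite /ev raddf_sum /=; apply: eq_bigr => a _; rewrite mmapZ mmapX mul_mpolyC.
  by congr (_ *: _); apply: eq_bigr => i _; rewrite mnmE.
have sumE : \sum_(s' < N) ev (P s') * b ^+ s' = 0.
  rewrite -[RHS]cE; under eq_bigr do rewrite evP mulr_suml.
  rewrite exchange_big pair_big /=; apply: eq_bigr => -[a s'] _ /=.
  by rewrite scalerAl.
have facE : b ^+ s * (ev (P s) + b * \sum_(s' < N | (s < s')%N) ev (P s') * b ^+ (s' - s.+1)) = 0.
  rewrite -[RHS]sumE [RHS](bigID (fun s' : 'I_N => (s < s')%N)) /= mulrDr addrC; congr (_ + _).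
    rewrite (bigD1 s) ?ltnn //= mulrC big1 ?addr0 // => s' /andP[s's nes].
    have /smin : (s' < s)%N by rewrite ltn_neqAle leqNgt s's andbT.
    by rewrite inord_val => ->; rewrite /ev raddf0 mul0r.
  rewrite mulrA -exprSr mulr_sumr; apply: eq_bigr => s' ss'.
  by rewrite mulrCA -exprD subnKC.
move/eqP: facE; rewrite mulf_eq0 expf_eq0 (negPf b0) andbF /= => /eqP facE.
exists (P s); split => // x bx.
have := congr1 (meval (x 0)) facE.
rewrite mevalD mevalM bx mul0r addr0 meval0 /ev.
have -> : meval (x 0) (mmap (@mpolyC r K) f (P s)) = (P s).@[fun i => (f i).@[x 0]].
  rewrite mmap_morph /meval /mmap; apply: eq_bigr => mm _; congr (_ * _).
  by rewrite /= -/(meval (x 0) _) mevalC.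
by [].
Qed.

(** If [F] does not vanish at a target, then no parameter over it is on the
    hypersurface [b = 0]: every claim about generic targets takes this form. *)
Lemma hypersurface_image r (f : 'rV[K]_r -> 'rV[K]_r) (b : 'rV[K]_r -> K) :
  (forall i, polyfun (fun x => f x 0 i)) -> polyfun b -> (exists x, b x != 0) ->
  exists F : {mpoly K[r]}, F != 0 /\ forall x, b x = 0 -> F.@[f x 0] = 0.
Proof.
move=> fP [B bB] [x0 bx0].
have /choice[G GP] : forall i, exists G : {mpoly K[r]}, forall x, f x 0 i = G.@[x 0] by [].
have B0 : B != 0 by apply: contraNneq bx0 => B0; rewrite bB B0 meval0.
have [F [F0 FP]] := hypersurface_dep G B0.
exists F; split => // x bx; rewrite -[RHS](FP x) -?bB //.
by apply: meval_eq => i; rewrite GP.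
Qed.

End Dominance.

(** * Binary forms as univariate polynomials *)

Section Coordinates.
Variables (K : numFieldType) (n : nat).
Implicit Types (p q g u : {poly K}) (a h : 'rV[K]_n.+1) (z : K).

(** [vec] and [hat] exchange the row of coordinates [a_i] and the polynomial with
    coefficients ['C(n, i) * a_i]. *)
Definition vec p : 'rV[K]_n.+1 := \row_i (p`_i / 'C(n, i)%:R).
Definition hat a : {poly K} := \poly_(i < n.+1) ('C(n, i)%:R * a 0 (inord i)).

Fact vec_is_linear : linear vec.
Proof.
by move=> c p q; apply/rowP => i; rewrite !mxE coefD coefZ mulrDl mulrA.
Qed.
HB.instance Definition _ := GRing.isLinear.Build K {poly K} 'rV[K]_n.+1 *:%R vec vec_is_linear.

Lemma binK_neq0 (i : 'I_n.+1) : 'C(n, i)%:R != 0 :> K.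
Proof. by rewrite pnatr_eq0 -lt0n bin_gt0 -ltnS. Qed.

Lemma size_hat a : (size (hat a) <= n.+1)%N.
Proof. exact: size_poly. Qed.

Lemma coef_hat a (i : 'I_n.+1) : (hat a)`_i = 'C(n, i)%:R * a 0 i.
Proof. by rewrite coef_poly ltn_ord inord_val. Qed.

Lemma hatK : cancel hat vec.
Proof.
by move=> a; apply/rowP => i; rewrite mxE coef_hat mulrC mulKf ?binK_neq0.
Qed.

Lemma vecK p : (size p <= n.+1)%N -> hat (vec p) = p.
Proof.
move=> sp; apply/polyP => i; have [iN|iN] := ltnP i n.+1; last first.
  by rewrite coef_poly ltnNge iN nth_default ?(leq_trans sp).
by rewrite (coef_hat _ (Ordinal iN)) mxE mulrC divfK ?binK_neq0.
Qed.

Lemma vec_inj p q : (size p <= n.+1)%N -> (size q <= n.+1)%N -> vec p = vec q -> p = q.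
Proof. by move=> /vecK {2}<- /vecK {2}<- ->. Qed.

Lemma size_hatP a N : (N <= n.+1)%N ->
  (size (hat a) <= N)%N <-> (forall i : 'I_n.+1, (N <= i)%N -> a 0 i = 0).
Proof.
move=> Nn; split=> [sa i Ni|ai].
  have := coef_hat a i; rewrite nth_default ?(leq_trans sa) // => /esym/eqP.
  by rewrite mulf_eq0 (negPf (binK_neq0 i)) => /eqP.
apply/leq_sizeP => j Nj; have [jn|jn] := ltnP j n.+1.
  by rewrite (coef_hat _ (Ordinal jn)) ai ?mulr0.
by rewrite nth_default // (leq_trans (size_hat _)).
Qed.

Lemma size_lexp z k q : size (('X - z%:P) ^+ k * q) = if q == 0 then 0%N else (k + size q)%N.
Proof.
case: eqP => [->|/eqP q0]; first by rewrite mulr0 size_poly0.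
by rewrite size_monicM ?monic_exp ?monicXsubC // size_exp_XsubC.
Qed.

Lemma leq_size_lexp z k N q : (size q <= N)%N -> (size (('X - z%:P) ^+ k * q)%R <= k + N)%N.
Proof. by rewrite size_lexp; case: ifP => // _; rewrite leq_add2l. Qed.

Lemma geq_size_lexp z k N q :
  (size (('X - z%:P) ^+ k * q)%R <= k + N)%N -> (size q <= N)%N.
Proof. by rewrite size_lexp; case: eqP => [->|_]; rewrite ?size_poly0 ?leq_add2l. Qed.

End Coordinates.

Arguments vec {K} n p.
Arguments hat {K n} a.

Section Homogenize.
Variables (K : numFieldType).
Implicit Types (p q g : {poly K}) (z : K).
Local Notation x0 := ('X_(ord0 : 'I_2) : {mpoly K[2]}).
Local Notation x1 := ('X_(ord_max : 'I_2) : {mpoly K[2]}).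

Definition homogenize n (p : {poly K}) : {mpoly K[2]} :=
  \sum_(i < n.+1) p`_i *: (x0 ^+ i * x1 ^+ (n - i)).

Lemma binary_formE n (a : 'rV[K]_n.+1) : binary_form a = homogenize n (hat a).
Proof. by apply: eq_bigr => i _; rewrite coef_hat. Qed.

Lemma homogenizeX n p : homogenize n.+1 ('X * p) = x0 * homogenize n p.
Proof.
rewrite /homogenize big_ord_recl coefXM eqxx scale0r add0r mulr_sumr.
by apply: eq_bigr => i _; rewrite coefXM /= subSS exprS -mulrA scalerAr.
Qed.

Lemma homogenizeS n p : (size p <= n.+1)%N -> homogenize n.+1 p = x1 * homogenize n p.
Proof.
move=> sp; rewrite /homogenize big_ord_recr /= (nth_default _ sp) scale0r addr0 mulr_sumr.
apply: eq_bigr => i _; rewrite -scalerAr mulrCA subSn -?exprS //.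
by rewrite -ltnS.
Qed.

Lemma homogenizeXsubC n p z : (size p <= n.+1)%N ->
  homogenize n.+1 (('X - z%:P) * p) = (x0 - z *: x1) * homogenize n p.
Proof.
move=> sp; rewrite mulrBl mulrBl -homogenizeX -scalerAl -homogenizeS //.
rewrite /homogenize scaler_sumr -sumrB; apply: eq_bigr => i _.
by rewrite mul_polyC coefB coefZ scalerBl scalerA.
Qed.

Lemma homogenize_lexp n p z k : (size p <= n.+1)%N ->
  homogenize (k + n) (('X - z%:P) ^+ k * p) = (x0 - z *: x1) ^+ k * homogenize n p.
Proof.
move=> sp; elim: k => [|k IHk]; first by rewrite !mul1r.
rewrite !exprS -!mulrA -IHk addSn homogenizeXsubC //.
by apply: leq_trans (leq_size_lexp _ _ sp) _; rewrite addnS.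
Qed.

Lemma homogenize_addn n p k : (size p <= n.+1)%N ->
  homogenize (k + n) p = x1 ^+ k * homogenize n p.
Proof.
move=> sp; elim: k => [|k IHk]; first by rewrite mul1r.
rewrite addSn exprS -mulrA -IHk homogenizeS // (leq_trans sp) //.
by rewrite ltnS leq_addl.
Qed.

(** The second alternative is a root of multiplicity [k] at infinity, where the
    linear factor is the second variable. *)
Lemma hook_coneP n k (a : 'rV[K]_n.+1) : (k <= n)%N -> hook_cone k a <->
  (exists z g, (size g <= (n - k).+1)%N /\ a = vec n (('X - z%:P) ^+ k * g)) \/
  (size (hat a) <= (n - k).+1)%N.
Proof.
move=> kn; rewrite /hook_cone binary_formE; split; last first.
  case=> [[z [g [sg ->]]]|sa].
    exists z, 1; split; first by rewrite xpair_eqE oner_eq0 andbF.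
    exists (homogenize (n - k) g); rewrite vecK; last first.
      by rewrite (leq_trans (leq_size_lexp _ _ sg)) // addnS subnKC.
    by rewrite scale1r -homogenize_lexp // subnKC.
  exists (-1), 0; split; first by rewrite xpair_eqE oppr_eq0 oner_eq0.
  exists (homogenize (n - k) (hat a)).
  by rewrite scale0r sub0r scaleN1r opprK -homogenize_addn // subnKC.
case=> s [t [st0 [g fE]]].
have [t0|t0] := eqVneq t 0.
  right; have s0 : s != 0 by move: st0; rewrite t0 xpair_eqE eqxx andbT.
  have := congr1 (mmap polyC (fun i : 'I_2 => if i == ord0 then 1 else 'X : {poly K})) fE.
  rewrite rmorphM rmorphXn rmorphB /= !mmapZ !mmapX !mmap1U /= t0 polyC0 mul0r sub0r.
  rewrite raddf_sum /= => E.
  have {}E j : (j <= n)%N -> (n - j < k)%N -> (hat a)`_j = 0.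
    move=> jn nj; have := congr1 (coefp (n - j)) E; rewrite /= coef_sum.
    rewrite exprNn -mulrA mulrCA exprMn -mulrA mulrCA coefXnM nj.
    move=> h; rewrite -[RHS]h (bigD1 (Ordinal (jn : (j < n.+1)%N))) //= big1.
      by rewrite mmapZ rmorphM /= !rmorphXn /= !mmapX !mmap1U /= expr1n mul1r coefCM coefXn eqxx mulr1 addr0.
    move=> i ij; rewrite mmapZ rmorphM /= !rmorphXn /= !mmapX !mmap1U /= expr1n mul1r coefCM coefXn.
    case: eqP => [e|]; rewrite ?mulr0 //; case/eqP: ij; apply: val_inj => /=.
    by have := ltn_ord i; lia.
  apply/leq_sizeP => j nj; have [jn|jn] := leqP j n; last first.
    by rewrite nth_default // (leq_trans (size_hat _)).
  by apply: E => //; lia.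
left; exists (s / t).
have := congr1 (mmap polyC (fun i : 'I_2 => if i == ord0 then 'X else 1 : {poly K})) fE.
rewrite rmorphM rmorphXn rmorphB /= !mmapZ !mmapX !mmap1U /= mulr1.
set g' := mmap _ _ g => E.
have {}E : hat a = ('X - (s / t)%:P) ^+ k * (t%:P ^+ k * g').
  rewrite mulrA -exprMn mulrBl (mulrC 'X) -polyCM divfK // -E raddf_sum /=.
  apply/polyP => j; rewrite coef_sum.
  have [jn|jn] := ltnP j n.+1; last first.
    rewrite big1 ?nth_default ?(leq_trans (size_hat _)) // => i _.
    rewrite mmapZ rmorphM /= !rmorphXn /= !mmapX !mmap1U /= expr1n mulr1 coefCM coefXn.
    by case: eqP => [ji|]; rewrite ?mulr0 //; move: (ltn_ord i); rewrite -ji ltnNge jn.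
  rewrite (bigD1 (Ordinal jn)) //= big1.
    by rewrite mmapZ rmorphM /= !rmorphXn /= !mmapX !mmap1U /= expr1n mulr1 coefCM coefXn eqxx mulr1 addr0.
  move=> i ij; rewrite mmapZ rmorphM /= !rmorphXn /= !mmapX !mmap1U /= expr1n mulr1 coefCM coefXn.
  by case: eqP => [e|]; rewrite ?mulr0 //; case/eqP: ij; apply: val_inj.
exists (t%:P ^+ k * g'); split; last by rewrite -E hatK.
by apply: (@geq_size_lexp _ (s / t) k); rewrite -E addnS subnKC ?size_hat.
Qed.

End Homogenize.

(** * Differentials and the squared distance *)

Section Calculus.
Variables (K : numFieldType) (m : nat).
Implicit Types (F G : {mpoly K[m]}) (gam : 'I_m -> {poly K}).

(** Both sides are derivations in [F] along the same morphism, so it is enough to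
    compare them on the variables. *)
Lemma chain_rule F gam :
  (mmap polyC gam F)^`() = \sum_i mmap polyC gam F^`M(i) * (gam i)^`().
Proof.
pose good F := (mmap polyC gam F)^`() = \sum_i mmap polyC gam F^`M(i) * (gam i)^`().
have good0 : good 0.
  by rewrite /good raddf0 deriv0 big1 // => i _; rewrite !raddf0 mul0r.
have goodD F1 F2 : good F1 -> good F2 -> good (F1 + F2).
  rewrite /good raddfD /= derivD => -> ->; rewrite -big_split; apply: eq_bigr => i _ /=.
  by rewrite mderivD raddfD mulrDl.
have goodM F1 F2 : good F1 -> good F2 -> good (F1 * F2).
  rewrite /good rmorphM /= derivM => -> ->; rewrite mulr_suml mulr_sumr -big_split.
  by apply: eq_bigr => i _ /=; rewrite mderivM raddfD /= !rmorphM /=; ring.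
have goodZ c F1 : good F1 -> good (c *: F1).
  rewrite /good mmapZ mul_polyC derivZ => ->; rewrite scaler_sumr; apply: eq_bigr => i _.
  by rewrite mderivZ mmapZ mul_polyC scalerAl.
have good1 : good 1.
  rewrite /good rmorph1 derivC big1 // => i _.
  by rewrite -mpolyC1 mderivC raddf0 mul0r.
have goodX i : good 'X_i.
  rewrite /good mmapX mmap1U (bigD1 i) //= mderivX mnm1E eqxx scale1r.
  have -> : (U_(i) - U_(i) = 0 :> 'X_{1..m})%MM by rewrite -{1}[U_(i)%MM]add0m addmK.
  rewrite mpolyX0 rmorph1 mul1r big1 ?addr0 // => j ij.
  by rewrite mderivX mnm1E eq_sym (negPf ij) scale0r raddf0 mul0r.
rewrite -/(good F) (mpolyE F); apply: big_ind => // mm _; apply: goodZ.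
rewrite mpolyXE_id; apply: big_ind => // i _.
elim: (mm i) => [|k IHk] //; rewrite exprS; exact: goodM.
Qed.

Lemma horner_mmap F gam e : (mmap polyC gam F).[e] = F.@[fun i => (gam i).[e]].
Proof.
rewrite -horner_evalE mmap_morph /meval /mmap; apply: eq_bigr => mm _.
by rewrite /= horner_evalE hornerC.
Qed.

Lemma deriv_along F gam e :
  (mmap polyC gam F)^`().[e] =
  \sum_i F^`M(i).@[fun i => (gam i).[e]] * (gam i)^`().[e].
Proof.
rewrite chain_rule horner_sum; apply: eq_bigr => i _.
by rewrite hornerM horner_mmap.
Qed.

Lemma horner_zero (p : {poly K}) : (forall e, p.[e] = 0) -> p = 0.
Proof.
move=> p0; apply: poly_nat_zero => [a b /eqP|a]; last exact: p0.
by rewrite eqr_nat => /eqP.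
Qed.

Lemma horner_inj (p q : {poly K}) : (forall e, p.[e] = q.[e]) -> p = q.
Proof.
move=> pq; apply/eqP; rewrite -subr_eq0; apply/eqP/horner_zero => e.
by rewrite hornerD hornerN pq subrr.
Qed.

Lemma differential_curve F gam (P : {poly K}) :
  (forall e, P.[e] = F.@[(\row_i (gam i).[e] : 'rV_m) 0]) ->
  differential F (\row_i (gam i).[0]) (\row_i (gam i)^`().[0]) = P^`().[0].
Proof.
move=> PE; have -> : P = mmap polyC gam F.
  apply: horner_inj => e; rewrite PE horner_mmap.
  by apply: meval_eq => i; rewrite mxE.
rewrite deriv_along; apply: eq_bigr => i _; rewrite mxE; congr (_ * _).
by apply: meval_eq => j; rewrite mxE.
Qed.

Lemma differential_line F (p v : 'rV[K]_m) (P : {poly K}) :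
  (forall e, P.[e] = F.@[(p + e *: v) 0]) -> differential F p v = P^`().[0].
Proof.
move=> PE; pose gam i := (p 0 i)%:P + v 0 i *: 'X.
have -> : p = \row_i (gam i).[0].
  by apply/rowP => i; rewrite mxE hornerD hornerC hornerZ hornerX mulr0 addr0.
have -> : v = \row_i (gam i)^`().[0].
  by apply/rowP => i; rewrite mxE derivD derivC add0r derivZ derivX hornerZ hornerC mulr1.
apply: differential_curve => e; rewrite PE; apply: meval_eq => i; rewrite !mxE.
by rewrite hornerD hornerC hornerZ hornerX (mulrC e).
Qed.

Lemma differential_curve_on (X : 'rV[K]_m -> Prop) F gam : vanishes_on X F ->
  (forall e, X (\row_i (gam i).[e])) ->
  differential F (\row_i (gam i).[0]) (\row_i (gam i)^`().[0]) = 0.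
Proof.
move=> FX gX; rewrite (@differential_curve F gam 0) ?deriv0 ?horner0 // => e.
by rewrite horner0 FX.
Qed.

Lemma differentialD F p v w : differential F p (v + w) = differential F p v + differential F p w.
Proof. by rewrite /differential -big_split; apply: eq_bigr => i _ /=; rewrite mxE mulrDr. Qed.

Lemma differentialZ F p c v : differential F p (c *: v) = c * differential F p v.
Proof. by rewrite /differential mulr_sumr; apply: eq_bigr => i _ /=; rewrite mxE mulrCA. Qed.

Lemma polyfun_differential r F (p v : 'rV[K]_r -> 'rV[K]_m) :
  (forall i, polyfun (fun x => p x 0 i)) -> (forall i, polyfun (fun x => v x 0 i)) ->
  polyfun (fun x => differential F (p x) (v x)).
Proof.
move=> pP vP; apply: polyfun_sum => i; apply: polyfunM => //.
exact: polyfun_meval.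
Qed.

Lemma tangentD (X : 'rV[K]_m -> Prop) p v w :
  tangent X p v -> tangent X p w -> tangent X p (v + w).
Proof. by move=> hv hw F FX; rewrite differentialD hv // hw // addr0. Qed.

Lemma tangentZ (X : 'rV[K]_m -> Prop) p c v : tangent X p v -> tangent X p (c *: v).
Proof. by move=> hv F FX; rewrite differentialZ hv // mulr0. Qed.

End Calculus.

Section Bilin.
Variables (A : comNzRingType) (m : nat) (Q : 'M[A]_m).
Implicit Types u v w : 'rV[A]_m.

Lemma bilinDl u v w : bilin Q (u + v) w = bilin Q u w + bilin Q v w.
Proof. by rewrite /bilin !mulmxDl mxE. Qed.
Lemma bilinDr u v w : bilin Q w (u + v) = bilin Q w u + bilin Q w v.
Proof. by rewrite /bilin linearD /= !mulmxDr mxE. Qed.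
Lemma bilinZl c u v : bilin Q (c *: u) v = c * bilin Q u v.
Proof. by rewrite /bilin -!scalemxAl mxE. Qed.
Lemma bilinZr c u v : bilin Q u (c *: v) = c * bilin Q u v.
Proof. by rewrite /bilin linearZ /= -!scalemxAr mxE. Qed.
Lemma bilinBl u v w : bilin Q (u - v) w = bilin Q u w - bilin Q v w.
Proof. by rewrite bilinDl -scaleN1r bilinZl mulN1r. Qed.
Lemma bilin0l w : bilin Q 0 w = 0.
Proof. by rewrite -(scale0r 0) bilinZl mul0r. Qed.
Lemma bilin0r w : bilin Q w 0 = 0.
Proof. by rewrite -(scale0r 0) bilinZr mul0r. Qed.
Lemma bilin_suml (I : Type) (s : seq I) (F : I -> 'rV[A]_m) w :
  bilin Q (\sum_(i <- s) F i) w = \sum_(i <- s) bilin Q (F i) w.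
Proof.
by elim: s => [|i s IHs]; rewrite ?big_nil ?bilin0l // !big_cons bilinDl IHs.
Qed.
Lemma bilin_sumr (I : Type) (s : seq I) (F : I -> 'rV[A]_m) w :
  bilin Q w (\sum_(i <- s) F i) = \sum_(i <- s) bilin Q w (F i).
Proof.
by elim: s => [|i s IHs]; rewrite ?big_nil ?bilin0r // !big_cons bilinDr IHs.
Qed.
Lemma bilin_sym u v : Q^T = Q -> bilin Q u v = bilin Q v u.
Proof.
move=> QT; rewrite /bilin.
have -> : u *m Q *m v^T = (v *m Q *m u^T)^T by rewrite !trmx_mul trmxK QT mulmxA.
by rewrite mxE.
Qed.
Lemma bilinE u v : bilin Q u v = \sum_j (u *m Q) 0 j * v 0 j.
Proof. by rewrite /bilin mxE; apply: eq_bigr => j _; rewrite [in RHS]mxE !mxE. Qed.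
End Bilin.

Section Distance.
Variables (K : numFieldType) (m : nat) (Q : 'M[K]_m).

Lemma meval_sqdist h (p : 'rV[K]_m) : (sqdist Q h).@[p 0] = bilin Q (p - h) (p - h).
Proof.
rewrite /sqdist /bilin !mxE rmorph_sum; apply: eq_bigr => j _; rewrite rmorphM !mxE.
congr (_ * _); last by rewrite rmorphB /= mevalXU mevalC.
rewrite rmorph_sum; apply: eq_bigr => i _; rewrite rmorphM !mxE /= mevalC.
by rewrite rmorphB /= mevalXU mevalC.
Qed.

Lemma differential_sqdist h p v : Q^T = Q ->
  differential (sqdist Q h) p v = 2%:R * bilin Q (p - h) v.
Proof.
move=> QT; move wE: (p - h) => w.
pose P := (bilin Q w w)%:P + (2%:R * bilin Q w v) *: 'X + bilin Q v v *: 'X^2.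
rewrite (@differential_line _ _ _ _ _ P); last first.
  move=> e; rewrite meval_sqdist addrAC wE bilinDl !bilinDr !(bilinZl, bilinZr).
  rewrite (bilin_sym v w QT) /P !hornerE /= ?hornerXn; ring.
rewrite /P !derivD derivC !derivZ derivX derivXn !hornerE /=; ring.
Qed.
End Distance.

(** * Tangent directions and limits in the hook cone *)

Section PolyCurves.
Variable K : numFieldType.
Implicit Types (G : {poly {poly K}}).

(** An element of [{poly {poly K}}] is seen as a curve of polynomials, whose
    parameter is the outer variable; [coef_curve i] is its [i]-th coordinate. *)
Definition coef_curve i G : {poly K} := map_poly (coefp i) G.

Lemma coef_curve_horner i G e : (coef_curve i G).[e] = (G.[e%:P])`_i.
Proof.
rewrite /coef_curve /map_poly horner_poly horner_coef coef_sum.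
by apply: eq_bigr => j _ /=; rewrite -rmorphXn /= coefMC.
Qed.

Lemma coef_curve_deriv i G : (coef_curve i G)^`() = coef_curve i G^`().
Proof.
apply/polyP => j; rewrite coef_deriv !coef_map_id0 ?raddf0 // coef_deriv.
by rewrite raddfMn.
Qed.

Section PencilCurve.
Variables (A : comNzRingType) (l a g u : A) (k : nat).
(** Along this curve both the multiple root and the cofactor of a form move. *)
Definition pencil : {poly A} := (l%:P - a *: 'X) ^+ k * (g%:P + u *: 'X).

Lemma horner_pencil e : pencil.[e] = (l - a * e) ^+ k * (g + u * e).
Proof. by rewrite /pencil hornerM horner_exp !hornerE. Qed.

End PencilCurve.

Lemma deriv_pencil0 (A : comNzRingType) (l a g u : A) c :
  (pencil l a g u c.+1)^`().[0] = l ^+ c * (l * u - (c.+1%:R * a) * g).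
Proof.
rewrite /pencil derivM deriv_exp derivB derivD !derivC !derivZ derivX.
rewrite !(hornerM, hornerD, hornerN, hornerMn, horner_exp, hornerZ, hornerC, hornerX) /=.
by rewrite -mulr_natr exprS !(mulr0, subr0, mulr1, add0r, addr0, sub0r); ring.
Qed.

Lemma ppolyfun_vec r n (p : 'rV[K]_r -> {poly K}) : ppolyfun p ->
  forall i, polyfun (fun x => vec n (p x) 0 i).
Proof.
move=> pP i; apply: (@polyfun_ext _ _ (fun x => (p x)`_i * ('C(n, i)%:R)^-1)).
  by move=> x; rewrite mxE.
by apply: polyfunM; [exact: pP | exact: polyfunC].
Qed.

Lemma deriv_lexp z k j (q : {poly K}) : (j <= k)%N ->
  exists q', (('X - z%:P) ^+ k * q)^`(j) = ('X - z%:P) ^+ (k - j) * q'.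
Proof.
elim: j => [|j IHj] jk; first by exists q; rewrite subn0.
have [|q' E] := IHj; first exact: ltnW.
move: E; rewrite -[(k - j)%N]prednK ?subn_gt0 // -subnS; move: (k - j.+1)%N => c E.
exists (q' *+ c.+1 + ('X - z%:P) * q'^`()).
rewrite derivnS E derivM deriv_exp derivXsubC mul1r /= mulrDr mulrnAl mulrnAr exprSr mulrA.
by [].
Qed.

Lemma nderivn_lexp0 z k j (q : {poly K}) : (j < k)%N ->
  (('X - z%:P) ^+ k * q)^`N(j).[z] = 0.
Proof.
move=> jk; have [q' E] := deriv_lexp z q (ltnW jk).
have := congr1 (horner^~ z) (nderivn_def j (('X - z%:P) ^+ k * q)).
rewrite E hornerM horner_exp hornerXsubC subrr expr0n subn_eq0 leqNgt jk mul0r.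
move/esym/eqP; rewrite -mulr_natr hornerM -polyC_natr hornerC mulf_eq0.
by rewrite pnatr_eq0 (gtn_eqF (fact_gt0 j)) orbF => /eqP.
Qed.

End PolyCurves.

Section HookCone.
Variables (K : numClosedFieldType) (n k : nat).
Hypotheses (k1 : (1 < k)%N) (kn : (k <= n)%N).
Implicit Types (p g u : {poly K}) (z : K).

Local Notation X := (@hook_cone K n k).
Local Notation N := (n - k).+1.

(** The multiple root is [z] and the cofactor is [g]. *)
Definition chart z g : 'rV[K]_n.+1 := vec n (('X - z%:P) ^+ k * g).
(** For a fixed root [z], these vectors form the space [W_z]. *)
Definition tdir z u : 'rV[K]_n.+1 := vec n (('X - z%:P) ^+ k.-1 * u).

Lemma size_chart z g : (size g <= N)%N -> (size (('X - z%:P) ^+ k * g)%R <= n.+1)%N.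
Proof. by move=> sg; apply: leq_trans (leq_size_lexp _ _ sg) _; lia. Qed.

Lemma size_tdir z u : (size u <= N.+1)%N -> (size (('X - z%:P) ^+ k.-1 * u)%R <= n.+1)%N.
Proof. by move=> sg; apply: leq_trans (leq_size_lexp _ _ sg) _; lia. Qed.

Lemma chart_on z g : (size g <= N)%N -> X (chart z g).
Proof. by move=> sg; apply/hook_coneP => //; left; exists z, g. Qed.

Lemma kR_neq0 : k%:R != 0 :> K.
Proof. by rewrite pnatr_eq0; lia. Qed.

(** If [g.[z] != 0] then [l ^+ k.-1 * u] is the velocity of a curve of the cone: take
    [u'] such that [g.[z] *: u = u.[z] *: g + l * u'], let the cofactor move with
    velocity [u'] and the root with velocity proportional to [u.[z]].  Scaling by
    [g.[z]] removes the division. *)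
Lemma tangent_chart_scaled z g u : (size g <= N)%N -> (size u <= N.+1)%N ->
  tangent X (chart z g) (g.[z] *: tdir z u).
Proof.
move=> sg su F FX.
have [u' u'E] : exists u', g.[z] *: u - u.[z] *: g = u' * ('X - z%:P).
  by apply/factor_theorem; rewrite rootE !hornerE mulrC subrr.
have su' : (size u' <= N)%N.
  rewrite -ltnS; have [->|u'0] := eqVneq u' 0; first by rewrite size_poly0.
  suff : (size (u' * ('X - z%:P))%R <= N.+1)%N.
    by rewrite size_Mmonic ?monicXsubC // size_XsubC addn2.
  rewrite -u'E; apply: leq_trans (size_polyD _ _) _; rewrite geq_max size_polyN.
  by rewrite !(leq_trans (size_scale_leq _ _)) // (leq_trans sg).
pose al := - u.[z] / k%:R.
pose G : {poly {poly K}} := pencil ('X - z%:P) al%:P g u' k.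
pose gam (i : 'I_n.+1) := 'C(n, i)%:R^-1 *: coef_curve i G.
have GE e : G.[e%:P] = ('X - (z + al * e)%:P) ^+ k * (g + u' * e%:P).
  by rewrite /G horner_pencil polyCD opprD addrA -polyCM.
have gamE e : \row_i (gam i).[e] = chart (z + al * e) (g + u' * e%:P).
  by apply/rowP => i; rewrite !mxE hornerZ coef_curve_horner GE mulrC.
have := @differential_curve_on K _ X F gam FX.
rewrite gamE mulr0 addr0 polyC0 mulr0 addr0 => H; rewrite -[RHS]H; last first.
  move=> e; rewrite gamE; apply: chart_on; apply: leq_trans (size_polyD _ _) _.
  rewrite geq_max sg mulrC mul_polyC; exact: leq_trans (size_scale_leq _ _) _.
congr (differential _ _ _); apply/rowP => i.
rewrite !mxE derivZ coef_curve_deriv hornerZ coef_curve_horner polyC0 [RHS]mulrC mulrA.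
congr (_ / _); rewrite -coefZ; congr (_`_ _).
have kE : k.-1.+1 = k by rewrite prednK // ltnW.
rewrite /G -[in pencil _ _ _ _ _]kE deriv_pencil0 kE.
have -> : ('X - z%:P) * u' - k%:R * al%:P * g = g.[z] *: u.
  rewrite (mulrC _ u') -u'E -polyC_natr -polyCM.
  have -> : k%:R * al = - u.[z] by rewrite /al mulrC divfK ?kR_neq0.
  by rewrite polyCN mulNr opprK mul_polyC subrK.
by rewrite scalerAr.
Qed.

(** At the points where [z] is also a root of [g], the curves give fewer
    directions, but [W_z] does not depend on [g]: conclude by continuity in [g]. *)
Lemma tangent_chart z g u : (size g <= N)%N -> (size u <= N.+1)%N ->
  tangent X (chart z g) (tdir z u).
Proof.
move=> sg su F FX.
pose gx (x : 'rV[K]_1) := g + (x 0 0)%:P.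
have H : forall x : 'rV[K]_1, differential F (chart z (gx x)) (tdir z u) = 0.
  apply: (@polyfun_dense _ _ _ (fun x => (gx x).[z])).
  - apply: polyfun_differential => i; last exact: polyfunC.
    apply: ppolyfun_vec; apply: ppolyfunM; first exact: ppolyfunK.
    by apply: ppolyfunD; [exact: ppolyfunK | apply/ppolyfunC/polyfunX].
  - apply: (@polyfun_ext _ _ (fun x => g.[z] + x 0 0)).
      by move=> x; rewrite !hornerE.
    by apply: polyfunD; [exact: polyfunC | exact: polyfunX].
  - exists (const_mx (1 - g.[z])); rewrite !hornerE mxE addrC subrK; exact: oner_neq0.
  move=> x gz; apply: (mulfI gz); rewrite mulr0 -differentialZ.
  apply: tangent_chart_scaled => //; apply: leq_trans (size_polyD _ _) _.
  by rewrite geq_max sg (leq_trans (size_polyC_leq1 _)).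
by have := H 0; rewrite /gx mxE polyC0 addr0.
Qed.

Lemma one_sub_scaleX (e : K) : e != 0 -> 1 - e *: 'X = (- e)%:P * ('X - (e^-1)%:P) :> {poly K}.
Proof.
move=> e0; rewrite mulrBr -polyCM mulNr mulfV // polyCN mulNr mul_polyC polyCN.
by rewrite opprK addrC.
Qed.

Lemma one_sub_scaleXn e j (p : {poly K}) : e != 0 ->
  (1 - e *: 'X) ^+ j * p = ('X - (e^-1)%:P) ^+ j * ((- e) ^+ j *: p).
Proof.
by move=> e0; rewrite one_sub_scaleX // exprMn -rmorphXn /= -mulrA mul_polyC scalerAr.
Qed.

Lemma ppolyfun_limit j (p : {poly K}) :
  ppolyfun (fun x : 'rV[K]_1 => (1 - x 0 0 *: 'X) ^+ j * p).
Proof.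
apply: ppolyfunM; last exact: ppolyfunK.
apply: ppolyfunXn; apply: ppolyfunD; first exact: ppolyfunK.
apply: ppolyfunN; apply: (@ppolyfun_ext _ _ (fun x => (x 0 0)%:P * 'X)).
  by move=> x; rewrite mul_polyC.
by apply: ppolyfunM; [apply/ppolyfunC/polyfunX | exact: ppolyfunK].
Qed.

(** The limit of [tangent_chart] when the root [e^-1] tends to infinity. *)
Lemma tangent_infinity g u : (size g <= N)%N -> (size u <= N.+1)%N ->
  tangent X (vec n g) (vec n u).
Proof.
move=> sg su F FX.
have H : forall x : 'rV[K]_1, differential F (vec n ((1 - x 0 0 *: 'X) ^+ k * g))
    (vec n ((1 - x 0 0 *: 'X) ^+ k.-1 * u)) = 0.
  apply: (@polyfun_dense _ _ _ (fun x => x 0 0)).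
  - by apply: polyfun_differential => i; apply/ppolyfun_vec/ppolyfun_limit.
  - exact: polyfunX.
  - by exists (const_mx 1); rewrite mxE oner_neq0.
  move=> x x0; rewrite !one_sub_scaleXn //; apply: tangent_chart => //;
  exact: leq_trans (size_scale_leq _ _) _.
by have := H 0; rewrite mxE scale0r subr0 !expr1n !mul1r.
Qed.

Lemma vanishes_on_chart (F : {mpoly K[n.+1]}) :
  (forall z g, (size g <= N)%N -> F.@[chart z g 0] = 0) -> vanishes_on X F.
Proof.
move=> F0 p /hook_coneP -/(_ kn)[[z [g [sg ->]]]|sp]; first exact: F0.
have H : forall x : 'rV[K]_1, F.@[(vec n ((1 - x 0 0 *: 'X) ^+ k * hat p)) 0] = 0.
  apply: (@polyfun_dense _ _ _ (fun x => x 0 0)).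
  - by apply: polyfun_meval => i; apply/ppolyfun_vec/ppolyfun_limit.
  - exact: polyfunX.
  - by exists (const_mx 1); rewrite mxE oner_neq0.
  move=> x x0; rewrite one_sub_scaleXn //; apply: F0.
  exact: leq_trans (size_scale_leq _ _) _.
by have := H 0; rewrite mxE scale0r subr0 expr1n mul1r hatK.
Qed.

(** The Hasse derivative of order [k.-1] of [t] has a root [z]: it is not constant, as
    [t] has degree [n >= k].  Then the remainder of [t] modulo [l ^+ k] has degree
    less than [k.-1], since its coefficient of degree [k.-1] is the value at [z] of
    that derivative.  So all the polynomials of degree exactly [n] agree with a
    chart point up to terms of degree less than [k.-1]. *)
Lemma chart_top_coords (t : {poly K}) : (size t <= n.+1)%N -> t`_n != 0 ->
  exists z g, (size g <= N)%N /\ (size (t - ('X - z%:P) ^+ k * g)%R <= k.-1)%N.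
Proof.
move=> st tn.
have st' : size t = n.+1.
  apply/eqP; rewrite eqn_leq st /= ltnNge; apply: contra tn => st''.
  by rewrite nth_default.
have [z] : exists z, root (t^`N(k.-1)) z.
  apply/closed_rootP; apply: contraNneq tn => s1.
  have : (t^`N(k.-1))`_N = 0 by rewrite nth_default // s1.
  rewrite coef_nderivn; have -> : (k.-1 + N = n)%N by lia.
  by move/eqP; rewrite mulrn_eq0 => /orP[|//]; rewrite -leqn0 leqNgt bin_gt0 => /negP; lia.
rewrite rootE => /eqP tz; pose L := ('X - z%:P) ^+ k.
have L0 : L \is monic by rewrite monic_exp ?monicXsubC.
have sL : size L = k.+1 by rewrite size_exp_XsubC.
have tE := divp_eq t L; exists z, (t %/ L); split.
  by rewrite size_divp ?monic_neq0 // st' sL; lia.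
have -> : t - L * (t %/ L) = t %% L by rewrite {1}tE mulrC addrC addKr.
have sr : (size (t %% L)%R <= k)%N by rewrite -ltnS -sL ltn_modp monic_neq0.
move: tz; rewrite {1}tE nderivnD hornerD (mulrC _ L) nderivn_lexp0 ?add0r; last by lia.
move=> r0; apply/leq_sizeP => j kj; have [jk|jk] := ltnP j k; last first.
  by rewrite nth_default // (leq_trans sr).
have -> : j = k.-1 by lia.
move: r0; suff -> : (t %% L)^`N(k.-1) = ((t %% L)`_k.-1)%:P by rewrite hornerC.
apply/polyP => i; rewrite coef_nderivn coefC; case: eqP => [->|/eqP i0].
  by rewrite addn0 binn.
by rewrite nth_default ?mul0rn // (leq_trans sr) //; lia.
Qed.
End HookCone.

(** * Dimension and generic smoothness *)

Section ChartCoordinates.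
Variables (K : numFieldType) (r N : nat).
Implicit Types (x : 'rV[K]_r.+1) (g : {poly K}).

(** A row of length [r.+1] stores the root [z], the [N] coefficients of [g], and then
    the parameters [w] of a normal vector. *)
Definition zpar x : K := x 0 ord0.
Definition gpar x : {poly K} := \poly_(i < N) x 0 (inord i.+1).
Definition wpar x (t : nat) : K := x 0 (inord (N.+1 + t)).
Definition mkpar (z : K) g (w : nat -> K) : 'rV[K]_r.+1 :=
  \row_i (if i == 0%N :> nat then z else if (i <= N)%N then g`_i.-1 else w (i - N.+1)%N).

Lemma polyfun_zpar : polyfun zpar.
Proof. exact: polyfunX. Qed.

Lemma ppolyfun_gpar : ppolyfun gpar.
Proof.
move=> i; apply: (@polyfun_ext _ _ (fun x => if (i < N)%N then x 0 (inord i.+1) else 0)).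
  by move=> x; rewrite coef_poly.
by case: (i < N)%N; [exact: polyfunX | exact: polyfunC].
Qed.

Lemma zpar_mk z g w : zpar (mkpar z g w) = z.
Proof. by rewrite /zpar mxE. Qed.

Lemma gpar_mk z g w : (N <= r)%N -> (size g <= N)%N -> gpar (mkpar z g w) = g.
Proof.
move=> Nr sg; apply/polyP => i; rewrite coef_poly; case: ltnP => iN; last first.
  by rewrite nth_default // (leq_trans sg).
by rewrite mxE inordK /= ?iN // ltnS (leq_trans iN).
Qed.

Lemma wpar_mk z g w t : (N + t < r)%N -> wpar (mkpar z g w) t = w t.
Proof.
move=> Nt; rewrite /wpar mxE inordK /= ?addSn //.
by rewrite ltnNge leq_addr /= subSS addKn.
Qed.

Lemma ppolyfun_XsubC (f : 'rV[K]_r.+1 -> K) k : polyfun f ->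
  ppolyfun (fun x => ('X - (f x)%:P) ^+ k).
Proof.
move=> fP; apply: ppolyfunXn; apply: ppolyfunD; first exact: ppolyfunK.
exact/ppolyfunN/ppolyfunC.
Qed.
End ChartCoordinates.

Section Smoothness.
Variables (K : numClosedFieldType) (n k : nat).
Hypotheses (k1 : (1 < k)%N) (kn : (k <= n)%N).
Implicit Types (p v : 'rV[K]_n.+1) (g u : {poly K}) (z : K).

Local Notation X := (@hook_cone K n k).
Local Notation N := (n - k).+1.
Local Notation chart := (@chart K n k).
Local Notation tdir := (@tdir K n k).

Definition chartpar r (x : 'rV[K]_r.+1) := chart (zpar x) (gpar N x).

Lemma polyfun_chartpar r i : polyfun (fun x : 'rV[K]_r.+1 => chartpar x 0 i).
Proof.
apply: ppolyfun_vec; apply: ppolyfunM; last exact: ppolyfun_gpar.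
exact/ppolyfun_XsubC/polyfun_zpar.
Qed.

Lemma chartpar_surj r z g : (N <= r)%N -> (size g <= N)%N ->
  exists x : 'rV[K]_r.+1, chartpar x = chart z g.
Proof.
by move=> Nr sg; exists (mkpar r N z g (fun=> 0)); rewrite /chartpar zpar_mk gpar_mk.
Qed.

Definition top_index (i : nat) : 'I_n.+1 := inord (k.-1 + i).

Lemma top_coords (v : 'rV[K]_N.+1) : v 0 ord_max != 0 ->
  exists z g, (size g <= N)%N /\
    forall i : 'I_N.+1, chart z g 0 (top_index i) = v 0 i.
Proof.
move=> vm.
pose t := \poly_(j < n.+1) (if (k.-1 <= j)%N then 'C(n, j)%:R * v 0 (inord (j - k.-1)) else 0).
have [||z [g [sg st]]] := chart_top_coords k1 kn (t := t).
- exact: size_poly.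
- rewrite coef_poly ltnSn ifT; last by lia.
  rewrite binn mul1r (_ : inord _ = ord_max) //.
  by apply/val_inj; rewrite /= inordK; lia.
exists z, g; split => // i.
have iN := ltn_ord i.
have iE : top_index i = (k.-1 + i)%N :> nat by rewrite /top_index inordK; lia.
have : (t - ('X - z%:P) ^+ k * g)`_(k.-1 + i) = 0.
  by rewrite nth_default // (leq_trans st) // leq_addr.
rewrite coefB => /eqP; rewrite subr_eq0 => /eqP tE.
rewrite mxE iE -tE coef_poly ifT; last by lia.
rewrite leq_addr addKn inord_val mulrC mulKf // -iE; exact: binK_neq0.
Qed.

(** By [top_coords] the highest coordinates are algebraically independent.
    Conversely, functions of the [n - k + 2] parameters of the chart are functions of
    one more parameter, restricted to the hypersurface where it vanishes, so
    [hypersurface_image] gives a relation between [n - k + 3] of them. *)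
Lemma hook_dimension : has_dimension X N.+1.
Proof.
split.
  exists (fun i => 'X_(top_index i)) => G G0.
  suff : G * 'X_ord_max = 0.
    move/eqP; rewrite mulf_eq0 => /orP[/eqP // | /eqP X0].
    by have := congr1 (meval (fun=> 1)) X0; rewrite mevalXU meval0 => /eqP; rewrite oner_eq0.
  apply: mpoly_zero_point => v; rewrite mevalM mevalXU.
  have [->|vm] := eqVneq (v 0 ord_max) 0; first by rewrite mulr0.
  have [z [g [sg pv]]] := top_coords vm.
  rewrite (_ : G.@[v 0] = 0) ?mul0r // -[RHS](G0 _ (chart_on kn z sg)).
  by apply: meval_eq => i; rewrite mevalXU pv.
case=> f find.
pose fx (x : 'rV[K]_N.+2) : 'rV[K]_N.+2 := \row_i (f i).@[chartpar x 0].
have [|||F [F0 FP]] := @hypersurface_image _ _ fx (fun x => x 0 ord_max).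
- move=> i; apply: (@polyfun_ext _ _ (fun x => (f i).@[chartpar x 0])).
    by move=> x; rewrite mxE.
  by apply: polyfun_meval => j; exact: polyfun_chartpar.
- exact: polyfunX.
- by exists (const_mx 1); rewrite mxE oner_neq0.
move/eqP: F0; apply; apply: find => p Xp.
have [|F' F'E] := @polyfun_meval K n.+1 N.+2 (fun (q : 'rV[K]_n.+1) i => (f i).@[q 0]) F.
  by move=> i; exists (f i).
rewrite F'E; move: p Xp; rewrite -/(vanishes_on X F').
apply: vanishes_on_chart => // z g sg; rewrite -F'E.
pose x := mkpar N.+1 N z g (fun=> 0).
have xE : chartpar x = chart z g by rewrite /chartpar zpar_mk gpar_mk.
have xm : x 0 ord_max = 0 by rewrite mxE /= ltnn.
rewrite -[RHS](FP x xm); apply: meval_eq => i.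
by rewrite mxE xE.
Qed.

Section Relations.
Variable j : 'I_n.+1.

Definition rel_index (i : 'I_N.+2) : 'I_n.+1 :=
  if unlift ord0 i is Some i' then top_index i' else j.
Definition rel_coords p : 'rV[K]_N.+2 := \row_i p 0 (rel_index i).

Lemma hook_relation : exists G : {mpoly K[N.+2]}, G != 0 /\
  forall p, X p -> G.@[rel_coords p 0] = 0.
Proof.
have [_ /forallNP /(_ (fun i => 'X_(rel_index i))) /existsNP[G]] := hook_dimension.
move=> /not_implyP[G0 Gn]; exists G; split; first by apply/eqP.
by move=> p Xp; rewrite -[RHS](G0 p Xp); apply: meval_eq => i; rewrite mevalXU mxE.
Qed.

Lemma deriv_eq0_const (p : {poly K}) : p^`() = 0 -> forall a b, p.[a] = p.[b].
Proof.
move=> p0 a b; suff -> : p = (p`_0)%:P by rewrite !hornerC.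
apply/polyP => -[|i]; rewrite coefC //=.
have := congr1 (fun q : {poly K} => q`_i) p0; rewrite coef_deriv coef0.
by move/eqP; rewrite mulrn_eq0 => /eqP.
Qed.

Lemma msize_mderiv_lt m (G : {mpoly K[m]}) i : G^`M(i) != 0 -> (msize G^`M(i) < msize G)%N.
Proof.
move=> D0; have := mlead_supp D0; rewrite mcoeff_msupp mcoeff_mderiv mulrn_eq0 /=.
rewrite -mcoeff_msupp => /msize_mdeg_lt.
by rewrite mdegD mdeg1 addn1 mlead_deg.
Qed.

(** A relation of minimal degree between the coordinate [j] and the highest ones:
    its derivative in the coordinate [j] cannot vanish on the cone, unless it is zero.
    In that case the relation only involves the highest coordinates, which
    are independent by [top_coords]. *)
Lemma separable_relation : exists G : {mpoly K[N.+2]},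
  (forall p, X p -> G.@[rel_coords p 0] = 0) /\
  exists z g, (size g <= N)%N /\ G^`M(ord0).@[rel_coords (chart z g) 0] != 0.
Proof.
have [G0 [G0n0 G0X]] := hook_relation.
move: {2}(msize G0) (leqnn (msize G0)) => s; elim: s G0 G0n0 G0X => [|s IHs] G Gn0 GX sG.
  by case/negP: Gn0; rewrite -msize_poly_eq0 -leqn0.
set D := G^`M(ord0).
have [H|H] := pselect (exists z g, (size g <= N)%N /\ D.@[rel_coords (chart z g) 0] != 0).
  by exists G.
have DX p : X p -> D.@[rel_coords p 0] = 0.
  have [|D' D'E] := @polyfun_meval K n.+1 N.+2 (fun q => rel_coords q 0) D.
    move=> i; apply: (@polyfun_ext _ _ (fun q => q 0 (rel_index i))); last exact: polyfunX.
    by move=> q; rewrite mxE.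
  rewrite D'E; move: p; rewrite -/(vanishes_on X D').
  apply: vanishes_on_chart => // z g sg; rewrite -D'E.
  by apply/eqP/negPn/negP => Dn; apply: H; exists z, g.
have [D0|Dn0] := eqVneq D 0; last first.
  by apply: (IHs D) => //; rewrite -ltnS (leq_trans (msize_mderiv_lt Dn0)).
case/eqP: Gn0; suff : G * 'X_ord_max = 0.
  move/eqP; rewrite mulf_eq0 => /orP[/eqP // | /eqP X0].
  by have := congr1 (meval (fun=> 1)) X0; rewrite mevalXU meval0 => /eqP; rewrite oner_eq0.
apply: mpoly_zero_point => v; rewrite mevalM mevalXU.
have [->|vm] := eqVneq (v 0 ord_max) 0; first by rewrite mulr0.
pose v' : 'rV[K]_N.+1 := \row_i v 0 (lift ord0 i).
have vm' : v' 0 ord_max != 0.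
  by rewrite mxE (_ : lift _ _ = ord_max) //; apply: val_inj.
have [z [g [sg pv]]] := top_coords vm'.
pose gam (i : 'I_N.+2) : {poly K} := (v 0 i)%:P + (i == ord0)%:R *: 'X.
have P0 : (mmap polyC gam G)^`() = 0.
  rewrite chain_rule big1 // => i _; rewrite derivD derivC add0r derivZ derivX.
  case: eqP => [->|_]; last by rewrite scale0r mulr0.
  by rewrite -/D D0 raddf0 mul0r.
have := deriv_eq0_const P0 0 (chart z g 0 j - v 0 ord0).
rewrite !horner_mmap => E.
rewrite (_ : G.@[v 0] = 0) ?mul0r // -[RHS](GX _ (chart_on kn z sg)).
transitivity (G.@[fun i => (gam i).[0]]).
  by apply: meval_eq => i; rewrite hornerD hornerC hornerZ hornerX mulr0 addr0.
rewrite E; apply: meval_eq => i; rewrite hornerD hornerC hornerZ hornerX [RHS]mxE /rel_index.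
case: (unliftP ord0 i) => [i' ->|->]; last by rewrite eqxx mul1r addrC subrK.
by rewrite eq_sym (negPf (neq_lift _ _)) mul0r addr0 pv mxE.
Qed.

Lemma differential_relation (G : {mpoly K[N.+2]}) p v :
  (forall p, X p -> G.@[rel_coords p 0] = 0) -> tangent X p v ->
  (forall i : 'I_N.+1, v 0 (top_index i) = 0) -> G^`M(ord0).@[rel_coords p 0] * v 0 j = 0.
Proof.
move=> GX Tv v0.
have [|F FE] := @polyfun_meval K n.+1 N.+2 (fun q => rel_coords q 0) G.
  move=> i; apply: (@polyfun_ext _ _ (fun q => q 0 (rel_index i))); last exact: polyfunX.
  by move=> q; rewrite mxE.
have FX : vanishes_on X F by move=> q Xq; rewrite -FE GX.
rewrite -[RHS](Tv F FX).
pose gam i : {poly K} := (p 0 (rel_index i))%:P + v 0 (rel_index i) *: 'X.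
rewrite (@differential_line _ _ F p v (mmap polyC gam G)); last first.
  move=> e; rewrite horner_mmap -FE; apply: meval_eq => i; rewrite !mxE.
  by rewrite hornerD hornerC hornerZ hornerX mulrC.
rewrite deriv_along big_ord_recl big1 ?addr0.
  congr (_ * _).
    apply: meval_eq => i; rewrite mxE.
    by rewrite hornerD hornerC hornerZ hornerX mulr0 addr0.
  rewrite derivD derivC add0r derivZ derivX hornerZ hornerC mulr1 /rel_index.
  by rewrite unlift_none.
move=> i _; rewrite derivD derivC add0r derivZ derivX hornerZ hornerC mulr1 /rel_index.
by rewrite liftK v0 mulr0.
Qed.
End Relations.

(** The projection to the highest coordinates is generically unramified: [good] is
    the product of the derivatives given by [separable_relation], for all [j]. *)
Lemma generic_immersion : exists good : 'rV[K]_n.+1 -> K,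
  [/\ polyfun good,
      exists x : 'rV[K]_n.+1, good (chartpar x) != 0 &
      forall p v, good p != 0 -> tangent X p v ->
        (forall i : 'I_n.+1, (k.-1 <= i)%N -> v 0 i = 0) -> v = 0].
Proof.
have /choice[G GP] := separable_relation.
pose D j p := (G j)^`M(ord0).@[rel_coords j p 0].
have DP j : polyfun (D j).
  apply: polyfun_meval => i; apply: (@polyfun_ext _ _ (fun q => q 0 (rel_index j i))); last exact: polyfunX.
  by move=> q; rewrite mxE.
exists (fun p => \prod_(j <- enum 'I_n.+1) D j p); split.
- exact: polyfun_prod.
- have [] // := @polyfun_neq0_prod K n.+1 _ (enum 'I_n.+1) (fun j x => D j (chartpar x)).
  + move=> j; apply: polyfun_meval => i.
    apply: (@polyfun_ext _ _ (fun x => chartpar x 0 (rel_index j i))); last exact: polyfun_chartpar.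
    by move=> q; rewrite [RHS]mxE.
  + move=> j; have [_ [z [g [sg H]]]] := GP j.
    have [|x xE] := @chartpar_surj n z g _ sg; first by lia.
    by exists x; rewrite xE.
  + by move=> x Hx; exists x.
- move=> p v gp Tv v0; apply/rowP => j; rewrite [RHS]mxE.
  have := differential_relation (proj1 (GP j)) Tv _ => H.
  have /eqP : D j p * v 0 j = 0.
    apply: H => i; apply: v0; rewrite /top_index.
    rewrite inordK ?leq_addr //; have := ltn_ord i; move: (nat_of_ord i) => ii; lia.
  rewrite mulf_eq0 => /orP[Dj|/eqP //].
  by case/negP: gp; rewrite prodf_seq_eq0; apply/hasP; exists j; rewrite ?mem_enum.
Qed.

End Smoothness.

(** * Tangent and normal spaces *)

Section TangentSpace.
Variables (K : numClosedFieldType) (n k : nat).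
Hypotheses (k1 : (1 < k)%N) (kn : (k <= n)%N).
Implicit Types (p v : 'rV[K]_n.+1) (g u : {poly K}) (z : K).

Local Notation X := (@hook_cone K n k).
Local Notation N := (n - k).+1.
Local Notation chart := (@chart K n k).
Local Notation tdir := (@tdir K n k).

Definition tdir_row z (u : 'rV[K]_N.+1) : 'rV[K]_n.+1 := tdir z (rVpoly u).

Fact tdir_is_linear z : linear (tdir z).
Proof.
by move=> c u v; rewrite /tdir mulrDr -scalerAr linearP.
Qed.

Fact tdir_row_is_linear z : linear (tdir_row z).
Proof. by move=> c u v; rewrite /tdir_row linearP tdir_is_linear. Qed.
HB.instance Definition _ z :=
  GRing.isLinear.Build K 'rV[K]_N.+1 'rV[K]_n.+1 *:%R (tdir_row z) (tdir_row_is_linear z).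

Lemma tdir_inj z u : (size u <= N.+1)%N -> tdir z u = 0 -> u = 0.
Proof.
move=> su; rewrite -(linear0 (vec n)) => /vec_inj E.
have /eqP : ('X - z%:P) ^+ k.-1 * u = 0.
  by apply: E; rewrite ?size_poly0 // size_tdir.
by rewrite mulf_eq0 expf_eq0 polyXsubC_eq0 andbF /= => /eqP.
Qed.

Definition tspace z : {vspace 'rV[K]_n.+1} := limg (linfun (tdir_row z)).

Lemma mem_tspace z v : (v \in tspace z) <-> exists u, (size u <= N.+1)%N /\ v = tdir z u.
Proof.
split=> [/memv_imgP[u _ ->]|[u [su ->]]].
  by exists (rVpoly u); rewrite lfunE size_poly.
by apply/memv_imgP; exists (poly_rV u); rewrite ?memvf // lfunE /= /tdir_row poly_rV_K.
Qed.

Lemma dim_tspace z : \dim (tspace z) = N.+1.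
Proof.
rewrite limg_dim_eq; first by rewrite dimvf /dim /= mul1n.
apply/eqP; rewrite -subv0; apply/subvP => u; rewrite memv_cap memvf memv_ker lfunE /= => /eqP.
rewrite /tdir_row => /tdir_inj H; rewrite memv0 -[u]rVpolyK H ?linear0 //.
exact: size_poly.
Qed.

Section Immersion.
Variable good : 'rV[K]_n.+1 -> K.
Hypothesis goodP : forall p v, good p != 0 -> tangent X p v ->
  (forall i : 'I_n.+1, (k.-1 <= i)%N -> v 0 i = 0) -> v = 0.

(** The remainder of a tangent vector modulo [l ^+ k.-1] is again a tangent vector, by
    [tangent_chart].  Its degree is less than [k.-1], so it vanishes. *)
Lemma tangent_good z g v : (size g <= N)%N -> good (chart z g) != 0 ->
  v \in tspace z <-> tangent X (chart z g) v.
Proof.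
move=> sg gp; rewrite mem_tspace; split=> [[u [su ->]]|Tv]; first exact: tangent_chart.
pose L := ('X - z%:P) ^+ k.-1; pose u := hat v %/ L.
have L0 : L != 0 by rewrite monic_neq0 ?monic_exp ?monicXsubC.
have sL : size L = k by rewrite size_exp_XsubC prednK // ltnW.
have su : (size u <= N.+1)%N.
  by rewrite size_divp // sL; apply: leq_trans (leq_sub2r _ (size_hat v)) _; lia.
exists u; split => //; apply/eqP; rewrite -subr_eq0; apply/eqP.
apply: (goodP gp).
  by rewrite -scaleN1r; apply: tangentD => //; apply: tangentZ; exact: tangent_chart.
move=> i ki; have -> : v - tdir z u = vec n (hat v %% L).
  rewrite -[v in LHS]hatK /tdir -linearB /=; congr (vec n _).
  by rewrite {1}(divp_eq (hat v) L) mulrC addrC addKr.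
rewrite mxE nth_default ?mul0r // (leq_trans _ ki) // -ltnS prednK ?(ltnW k1) //.
by rewrite -sL ltn_modp.
Qed.

Lemma smooth_good z g : (size g <= N)%N -> good (chart z g) != 0 ->
  smooth_point X (chart z g).
Proof.
move=> sg gp; split; first exact: chart_on.
exists (tspace z); split; first by move=> v; exact: tangent_good.
by rewrite dim_tspace; exact: hook_dimension.
Qed.

End Immersion.
End TangentSpace.

Section Normal.
Variables (K : numClosedFieldType) (n k : nat).
Hypotheses (k1 : (1 < k)%N) (kn : (k <= n)%N).
Implicit Types (p v h : 'rV[K]_n.+1) (g u : {poly K}) (z : K).
Variable Q : 'M[K]_n.+1.

Local Notation X := (@hook_cone K n k).
Local Notation N := (n - k).+1.
Local Notation chart := (@chart K n k).
Local Notation tdir := (@tdir K n k).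

Definition normal_at z v := forall u, (size u <= N.+1)%N -> bilin Q v (tdir z u) = 0.

Lemma bilin_vec v (p : {poly K}) : bilin Q v (vec n p) = \sum_j (v *m Q) 0 j * (p`_j / 'C(n, j)%:R).
Proof. by rewrite bilinE; apply: eq_bigr => j _; rewrite [vec _ _ _ _]mxE. Qed.

Lemma bilin_vecXn v (i : 'I_n.+1) : bilin Q v (vec n 'X^i) = (v *m Q) 0 i / 'C(n, i)%:R.
Proof.
rewrite bilin_vec (bigD1 i) //= coefXn eqxx big1 => [|j ji]; first by rewrite addr0 mul1r.
by rewrite coefXn (negPf (_ : j != i :> nat)) ?mul0r ?mulr0.
Qed.

Lemma Xn_taylor z (i : nat) : (i <= n)%N ->
  'X^i = \sum_(t < n.+1) ('C(i, t)%:R * z ^+ (i - t)) *: ('X - z%:P) ^+ t.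
Proof.
move=> i_n; rewrite -{1}['X](subrK z%:P) addrC exprDn.
rewrite (big_ord_widen n.+1 (fun t => (z%:P ^+ (i - t) * ('X - z%:P) ^+ t) *+ 'C(i, t))) //.
rewrite big_mkcond; apply: eq_bigr => t _; case: ltnP => it.
  by rewrite -rmorphXn /= mul_polyC -scaler_nat scalerA.
by rewrite bin_small // mul0r scale0r.
Qed.

(** The functionals on polynomials that annihilate [W_z] are the combinations of the
    Hasse derivatives at [z] of order less than [k.-1]. *)
Definition normal_row z (w : nat -> K) : 'rV[K]_n.+1 :=
  \row_i ('C(n, i)%:R * \sum_(t < k.-1) 'C(i, t)%:R * z ^+ (i - t) * w t).

Lemma normal_at_row z v : normal_at z v -> exists w, v *m Q = normal_row z w.
Proof.
move=> nv; exists (fun t => bilin Q v (vec n (('X - z%:P) ^+ t))); apply/rowP => i.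
have -> : (v *m Q) 0 i = 'C(n, i)%:R * bilin Q v (vec n 'X^i).
  by rewrite bilin_vecXn mulrC divfK ?binK_neq0.
have i_n : (i <= n)%N by rewrite -ltnS.
rewrite [RHS]mxE; apply: (congr1 (fun y => 'C(n, i)%:R * y)).
transitivity (\sum_(t < n.+1) 'C(i, t)%:R * z ^+ (i - t) * bilin Q v (vec n (('X - z%:P) ^+ t))).
  rewrite (Xn_taylor z i_n) linear_sum bilin_sumr; apply: eq_bigr => t _.
  by rewrite linearZ bilinZr.
have kn' : (k.-1 <= n.+1)%N by lia.
rewrite [RHS](big_ord_widen n.+1
  (fun t => 'C(i, t)%:R * z ^+ (i - t) * bilin Q v (vec n (('X - z%:P) ^+ t))) kn').
rewrite [RHS]big_mkcond; apply: eq_bigr => t _; case: ltnP => // kt.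
rewrite (_ : vec n _ = tdir z (('X - z%:P) ^+ (t - k.-1))); last first.
  by rewrite /tdir -exprD subnKC.
rewrite nv ?mulr0 // size_exp_XsubC; have := ltn_ord t; lia.
Qed.

(** All the [h] for which [h - p] is orthogonal to [W_z], where [p] is the chart
    point with coordinates [z] and [g]. *)
Definition normal_param (x : 'rV[K]_n.+1) : 'rV[K]_n.+1 :=
  chartpar n k x + normal_row (zpar x) (wpar N x) *m invmx Q.

Lemma polyfun_mulmxr (f : 'rV[K]_n.+1 -> 'rV[K]_n.+1) (A : 'M[K]_n.+1) :
  (forall i, polyfun (fun x => f x 0 i)) -> forall i, polyfun (fun x => (f x *m A) 0 i).
Proof.
move=> fP i; apply: (@polyfun_ext _ _ (fun x => \sum_j f x 0 j * A j i)).
  by move=> x; rewrite [RHS]mxE.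
by apply: polyfun_sum => j; apply: polyfunM; [exact: fP | exact: polyfunC].
Qed.

Lemma polyfun_add_row (f g : 'rV[K]_n.+1 -> 'rV[K]_n.+1) i :
  polyfun (fun x => f x 0 i) -> polyfun (fun x => g x 0 i) ->
  polyfun (fun x => (f x + g x) 0 i).
Proof.
by move=> fP gP; apply: polyfun_ext (polyfunD fP gP) => x; rewrite [RHS]mxE.
Qed.

Lemma polyfun_normal_row r (f : 'rV[K]_r -> K) (w : 'rV[K]_r -> nat -> K) i :
  polyfun f -> (forall t, polyfun (w^~ t)) ->
  polyfun (fun x => normal_row (f x) (w x) 0 i).
Proof.
move=> fP wP; apply: (@polyfun_ext _ _ (fun x => 'C(n, i)%:R *
   \sum_(t < k.-1) 'C(i, t)%:R * f x ^+ (i - t) * w x t)).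
  by move=> x; rewrite [RHS]mxE.
apply: polyfunM; first exact: polyfunC.
apply: polyfun_sum => t; apply: polyfunM => //; apply: polyfunM; first exact: polyfunC.
exact: polyfunXn.
Qed.

Lemma polyfun_normal_param i : polyfun (fun x => normal_param x 0 i).
Proof.
apply: polyfun_add_row; first exact: polyfun_chartpar.
apply: polyfun_mulmxr => j; apply: polyfun_normal_row; first exact: polyfun_zpar.
by move=> t; exact: polyfunX.
Qed.

Lemma normal_param_surj z g h : Q \in unitmx -> (size g <= N)%N ->
  normal_at z (h - chart z g) ->
  exists x, [/\ zpar x = z, gpar N x = g & normal_param x = h].
Proof.
move=> Qu sg /normal_at_row[w wE]; exists (mkpar n N z g w).
have gE : gpar N (mkpar n N z g w) = g by rewrite gpar_mk //; lia.
split; rewrite ?zpar_mk // /normal_param /chartpar zpar_mk gE.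
have -> : normal_row z (wpar N (mkpar n N z g w)) = normal_row z w.
  apply/rowP => i; rewrite !mxE; congr (_ * _); apply: eq_bigr => t _.
  by rewrite wpar_mk //; have := ltn_ord t; lia.
by rewrite -wE mulmxK // addrC subrK.
Qed.

(** The same at infinity, where [W_z] becomes the space of polynomials of degree at
    most [N]: a functional that vanishes on it is given by its last coordinates.  As
    [zpar x] does not occur, the hyperplane [zpar x = 0] has the same image. *)
Definition normal_inf (x : 'rV[K]_n.+1) : 'rV[K]_n.+1 :=
  vec n (gpar N x) + (\row_i (if (i <= N)%N then 0 else x 0 i)) *m invmx Q.

Lemma polyfun_normal_inf i : polyfun (fun x => normal_inf x 0 i).
Proof.
apply: polyfun_add_row; first by apply/ppolyfun_vec/ppolyfun_gpar.
apply: polyfun_mulmxr => j; apply: (@polyfun_ext _ _ (fun x => if (j <= N)%N then 0 else x 0 j)).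
  by move=> x; rewrite mxE.
by case: (j <= N)%N; [exact: polyfunC | exact: polyfunX].
Qed.

Lemma normal_inf_surj g h : Q \in unitmx -> (size g <= N)%N ->
  (forall u, (size u <= N.+1)%N -> bilin Q (h - vec n g) (vec n u) = 0) ->
  exists x, zpar x = 0 /\ normal_inf x = h.
Proof.
move=> Qu sg nv; pose y := (h - vec n g) *m Q.
pose w t := y 0 (inord (N.+1 + t)).
exists (mkpar n N 0 g w); split; first by rewrite zpar_mk.
rewrite /normal_inf gpar_mk //; last by lia.
have -> : \row_i (if (i <= N)%N then 0 else mkpar n N 0 g w 0 i) = y.
  apply/rowP => i; rewrite mxE; case: (leqP i N) => iN.
    have := bilin_vecXn (h - vec n g) i; rewrite nv ?size_polyXn //.
    by move/esym/eqP; rewrite mulf_eq0 invr_eq0 (negPf (binK_neq0 _ i)) orbF => /eqP.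
  rewrite mxE ifN; last by rewrite -lt0n; lia.
  by rewrite ifN -?ltnNge // /w subnKC // inord_val.
by rewrite /y mulmxK // addrC subrK.
Qed.

End Normal.

(** * Critical points as roots of a resolvent *)

Section Criterion.
Variables (K : numClosedFieldType) (n k : nat).
Hypotheses (k1 : (1 < k)%N) (kn : (k <= n)%N).
Implicit Types (p v h : 'rV[K]_n.+1) (g u : {poly K}) (z : K).

Local Notation X := (@hook_cone K n k).
Local Notation N := (n - k).+1.
Local Notation chart := (@chart K n k).
Local Notation tdir := (@tdir K n k).

Variable Q : 'M[K]_n.+1.
Hypotheses (Qsym : Q^T = Q) (Qu : Q \in unitmx).
Local Notation normal_at := (@normal_at K n k Q).

Variables (E : {poly K}) (c : 'I_n.+1 -> {poly K}) (D : nat).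

Definition resolvent h : {poly K} := \sum_j h 0 j *: c j.

Hypothesis E0 : E.[0] != 0.
Hypothesis resolventP : forall z h, E.[z] != 0 ->
  (exists g, (size g <= N)%N /\ normal_at z (h - chart z g)) <-> (resolvent h).[z] = 0.
Hypothesis resolvent_excess : forall z, E.[z] = 0 -> exists j, (c j).[z] != 0.
Hypothesis size_c : forall j, (size (c j) <= D.+1)%N.
Hypothesis lead_c : exists j, (c j)`_D != 0.
Hypothesis transverse0 :
  ~ exists g, (size g <= N)%N /\ normal_at 0 (tdir 0 1 - chart 0 g).
Hypothesis normal_inj : forall z g, E.[z] != 0 -> (size g <= N)%N ->
  normal_at z (chart z g) -> g = 0.

Lemma horner_resolvent h z : (resolvent h).[z] = \sum_j h 0 j * (c j).[z].
Proof. by rewrite horner_sum; apply: eq_bigr => j _; rewrite hornerZ. Qed.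

Lemma horner_deriv_resolvent h z : (resolvent h)^`().[z] = \sum_j h 0 j * (c j)^`().[z].
Proof.
by rewrite raddf_sum horner_sum; apply: eq_bigr => j _; rewrite /= derivZ hornerZ.
Qed.

(** The resolvent of [l_z ^+ k] vanishes at [z] for all [z]; differentiating this
    identity at [z = 0], the derivative of the resolvent of ['X ^+ k] at [0] is, up to
    a factor [k], its value for the target ['X ^+ k.-1], which is not zero by
    transversality. *)
Lemma resolvent_simple0 : (resolvent (chart 0 1))^`().[0] != 0.
Proof.
pose gam (j : 'I_n.+1) : {poly K} := 'C(n, j)%:R^-1 *: coef_curve j (pencil ('X : {poly K}) 1 1 0 k).
have gamE z j : (gam j).[z] = chart z 1 0 j.
  rewrite hornerZ coef_curve_horner horner_pencil mul1r mul0r addr0 mulr1.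
  by rewrite [RHS]mxE mulrC mulr1.
have gamD j : (gam j)^`().[0] = - k%:R * tdir 0 1 0 j.
  rewrite derivZ hornerZ coef_curve_deriv coef_curve_horner polyC0.
  have kE : k.-1.+1 = k by rewrite prednK // ltnW.
  rewrite -[in pencil _ _ _ _ _]kE deriv_pencil0 kE.
  rewrite [tdir _ _ _ _]mxE subr0 !mulr1 mulr0 sub0r mulrN coefN -polyC_natr coefMC.
  move: (_`_j) (_^-1) (k%:R : K) => a b e; ring.
pose R := \sum_j gam j * c j.
have RE z : R.[z] = (resolvent (chart z 1)).[z].
  rewrite horner_resolvent horner_sum; apply: eq_bigr => j _.
  by rewrite hornerM gamE.
have R0 : R = 0.
  have : E * R = 0.
    apply: horner_zero => z; rewrite hornerM.
    have [->|Ez] := eqVneq E.[z] 0; first by rewrite mul0r.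
    rewrite RE ((resolventP _ Ez).1) ?mulr0 //; exists 1; rewrite size_poly1; split => //.
    by move=> u _; rewrite subrr bilin0l.
  move/eqP; rewrite mulf_eq0 => /orP[/eqP E00|/eqP //].
  by case/negP: E0; rewrite E00 horner0.
have := congr1 (fun p : {poly K} => p^`().[0]) R0.
rewrite /= deriv0 horner0 raddf_sum horner_sum => R0'.
apply: contra_notN transverse0 => /eqP H; apply/resolventP => //.
suff : - k%:R * (resolvent (tdir 0 1)).[0] = 0.
  by move/eqP; rewrite mulf_eq0 oppr_eq0 (negPf (kR_neq0 K k1 kn)) => /eqP.
rewrite -[RHS]R0'.
rewrite horner_resolvent mulr_sumr -[LHS]addr0 -[X in _ + X]H.
rewrite horner_deriv_resolvent -big_split; apply: eq_bigr => j _ /=.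
by rewrite derivM hornerD !hornerM gamD gamE mulrA.
Qed.

Lemma critical_hook h p :
  critical_point X (sqdist Q h) p ->
  smooth_point X p /\ forall v, tangent X p v -> bilin Q (h - p) v = 0.
Proof.
case=> sp cp; split=> // v Tv; have := cp v Tv.
rewrite differential_sqdist // => /eqP; rewrite mulf_eq0 pnatr_eq0 /= => /eqP H.
by rewrite -opprB -scaleN1r bilinZl H mulr0.
Qed.

Lemma polyfun_resolvent_lin (a : 'I_n.+1 -> K) : polyfun (fun h : 'rV[K]_n.+1 => \sum_j h 0 j * a j).
Proof. by apply: polyfun_sum => j; apply: polyfunM; [exact: polyfunX | exact: polyfunC]. Qed.

Lemma lin_neq0 (a : 'I_n.+1 -> K) : (exists j, a j != 0) ->
  exists h : 'rV[K]_n.+1, \sum_j h 0 j * a j != 0.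
Proof.
move=> [j aj]; exists (delta_mx 0 j); rewrite (bigD1 j) //= big1 => [|i ij].
  by rewrite mxE !eqxx mul1r addr0.
by rewrite mxE eqxx (negPf ij) mul0r.
Qed.

(** [E] collects the values of the root for which the resolvent does not detect
    solvability.  A generic [h] avoids the image under [normal_param] of the
    hypersurface [b = 0], so that at each critical candidate [E] does not vanish, the
    point is smooth with tangent space [W_z], and [z] is a simple root.  It
    moreover avoids the targets having a candidate at infinity, those for which the
    degree drops below [D], and those whose resolvent vanishes at a root of [E]. *)
Theorem EDdegree_criterion : is_EDdegree Q X D.
Proof.
have k10 : (k.-1 == 0)%N = false by rewrite -subn1 subn_eq0 leqNgt k1.
have [good [goodP [x0 gx0] goodT]] := generic_immersion K k1 kn.
pose b1 (x : 'rV[K]_n.+1) := E.[zpar x] * good (chartpar n k x).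
pose b2 (x : 'rV[K]_n.+1) := (resolvent (normal_param k Q x))^`().[zpar x].
pose b x := b1 x * b2 x.
have gP : polyfun (fun x : 'rV[K]_n.+1 => good (chartpar n k x)).
  case: goodP => G GE; apply: (@polyfun_ext _ _ (fun x => G.@[chartpar n k x 0])).
    by move=> x; rewrite -GE.
  by apply: polyfun_meval => i; exact: polyfun_chartpar.
have EP : polyfun (fun x : 'rV[K]_n.+1 => E.[zpar x]) by exact/polyfun_horner/polyfun_zpar.
have b1P : polyfun b1 by exact: polyfunM.
have b2P : polyfun b2.
  apply: (@polyfun_ext _ _ (fun x => \sum_j normal_param k Q x 0 j * (c j)^`().[zpar x])).
    by move=> x; rewrite -horner_deriv_resolvent.
  apply: polyfun_sum => j; apply: polyfunM; first exact: polyfun_normal_param.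
  exact/polyfun_horner/polyfun_zpar.
have bP : polyfun b by exact: polyfunM.
have b_n0 : exists x, b x != 0.
  apply: polyfun_neq0M => //.
    apply: polyfun_neq0M => //; last by exists x0.
    by exists 0; rewrite /zpar mxE.
  exists (mkpar n N (0 : K) (1 : {poly K}) (fun=> 0)); rewrite /b2 zpar_mk.
  rewrite (_ : normal_param _ _ _ = chart 0 1); first exact: resolvent_simple0.
  rewrite /normal_param /chartpar zpar_mk gpar_mk ?size_poly1 //; last by lia.
  rewrite (_ : normal_row _ _ _ _ = 0) ?mul0mx ?addr0 //.
  apply/rowP => i; rewrite !mxE big1 ?mulr0 // => t _.
  by rewrite wpar_mk ?mulr0 //; have := ltn_ord t; lia.
have [Fb [Fb0 FbP]] := hypersurface_image (polyfun_normal_param k Q) bP b_n0.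
have [|Fi [Fi0 FiP]] := hypersurface_image (polyfun_normal_inf k Q) (polyfunX K (ord0 : 'I_n.+1)).
  by exists (const_mx 1); rewrite mxE oner_neq0.
have [[Fl FlP] [hl hlP]] := (polyfun_resolvent_lin (fun j => (c j)`_D), lin_neq0 lead_c).
have [rs rsE] := closed_field_poly_normal E.
(* [Ex z] excludes the targets whose resolvent vanishes at a root [z] of [E]. *)
pose Ex z h := if E.[z] == 0 then (resolvent h).[z] else 1.
have ExP z : polyfun (Ex z).
  rewrite /Ex; case: eqP => _; last exact: polyfunC.
  apply: (polyfun_ext _ (polyfun_resolvent_lin (fun j => (c j).[z]))) => h.
  by rewrite horner_resolvent.
have Exn0 z : exists h, Ex z h != 0.
  rewrite /Ex; case: eqP => Ez; last by exists 0; exact: oner_neq0.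
  have [h hP] := lin_neq0 (resolvent_excess Ez); exists h.
  by rewrite horner_resolvent.
have [Fe FeP] : polyfun (fun h => \prod_(z <- rs) Ex z h) by exact: polyfun_prod.
have [he heP] := polyfun_neq0_prod rs ExP Exn0.
exists (Fb * Fi * Fl * Fe); split.
  have n0 : Fb * Fi * Fl * Fe != 0.
    rewrite !mulf_neq0 //.
      by apply: contraNneq hlP => F0; rewrite FlP F0 meval0.
    by apply: contraNneq heP => F0; rewrite FeP F0 meval0.
  by have [h hP] := mpoly_neq0_point n0; exists h.
move=> h _; rewrite !mevalM !mulf_eq0 !negb_or -!andbA => /and4P[hb hi hl' he'].
have param z g : (size g <= N)%N -> normal_at z (h - chart z g) ->
    [/\ E.[z] != 0, good (chart z g) != 0 & (resolvent h)^`().[z] != 0].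
  move=> sg nz; have [x [xz xg xh]] := normal_param_surj k1 kn Qu sg nz.
  have : b x != 0 by apply: contraNneq hb => /FbP; rewrite xh => ->.
  by rewrite /b /b1 /b2 /chartpar xz xg xh !mulf_eq0 !negb_or -andbA => /and3P.
have Eroot z : (resolvent h).[z] = 0 -> E.[z] != 0.
  move=> rz; apply/negP => /eqP Ez; case/negP: he'; rewrite -FeP.
  rewrite prodf_seq_eq0; apply/hasP; exists z; last by rewrite /Ex Ez eqxx rz eqxx.
  have : root E z by apply/rootP.
  rewrite rsE rootZ ?root_prod_XsubC // lead_coef_eq0.
  by apply: contraNneq E0 => ->; rewrite horner0.
have lin z : (resolvent h).[z] = 0 -> exists g, (size g <= N)%N /\ normal_at z (h - chart z g).
  by move=> rz; apply/resolventP => //; exact: Eroot.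
have hD : (resolvent h)`_D != 0.
  rewrite coef_sum; under eq_bigr do rewrite coefZ.
  by rewrite FlP.
have sh : size (resolvent h) = D.+1.
  apply/eqP; rewrite eqn_leq; apply/andP; split.
    apply: leq_trans (size_sum _ _ _) _; apply/bigmax_leqP => j _.
    exact: leq_trans (size_scale_leq _ _) (size_c j).
  by rewrite ltnNge; apply: contra hD => s; rewrite nth_default.
have hn0 : resolvent h != 0 by rewrite -size_poly_eq0 sh.
have [zs zsE] := closed_field_poly_normal (resolvent h).
have zsP z : (z \in zs) = ((resolvent h).[z] == 0).
  by rewrite -rootE zsE rootZ ?root_prod_XsubC // lead_coef_eq0.
have szs : size zs = D.
  by move: sh; rewrite zsE size_scale ?lead_coef_eq0 // size_prod_XsubC => -[].
have uzs : uniq zs.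
  rewrite -separable.separable_prod_XsubC separable.separable_poly.unlock.
  apply/Pdiv.ClosedField.coprimepP => z.
  rewrite root_prod_XsubC zsP => /eqP rz.
  have [g [sg ng]] := lin _ rz; have [_ _] := param _ _ sg ng.
  rewrite zsE derivZ hornerZ mulf_eq0 negb_or => /andP[_].
  by [].
have /choice[gz gzP] : forall z, exists g, (resolvent h).[z] = 0 ->
    (size g <= N)%N /\ normal_at z (h - chart z g).
  move=> z; have [/lin[g gzP]|nz] := pselect ((resolvent h).[z] = 0); first by exists g.
  by exists 0.
(* Distinct roots give distinct points since they have distinct tangent spaces. *)
exists [seq chart z (gz z) | z <- zs]; split.
- rewrite map_inj_in_uniq // => z z'; rewrite !zsP => /eqP/gzP[sg ng] /eqP/gzP[sg' ng'] zz'.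
  apply/eqP/negPn/negP => nzz'.
  have [_ gd _] := param _ _ sg ng; have [_ gd' _] := param _ _ sg' ng'.
  have : tdir z 1 \in tspace n k z by apply/mem_tspace; exists 1; rewrite size_poly1.
  move/(tangent_good k1 kn goodT _ sg gd); rewrite zz'.
  move/(tangent_good k1 kn goodT _ sg' gd')/mem_tspace => [u [su /vec_inj uE]].
  have {}uE : ('X - z%:P) ^+ k.-1 * 1 = ('X - z'%:P) ^+ k.-1 * u.
    by apply: uE; [apply: size_tdir; rewrite ?size_poly1 | apply: size_tdir].
  have /eqP := congr1 (horner^~ z') uE.
  rewrite !hornerM !horner_exp !hornerXsubC subrr expr0n hornerC mulr1.
  rewrite k10 mul0r.
  by rewrite expf_eq0 subr_eq0 eq_sym (negPf nzz') andbF.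
- by rewrite size_map.
move=> p; split=> [/mapP[z]|].
  rewrite zsP => /eqP/gzP[sg ng] ->.
  have [_ gd _] := param _ _ sg ng.
  split; first exact: smooth_good goodT _ _ sg gd.
  move=> v /(tangent_good k1 kn goodT _ sg gd)/mem_tspace[u [su ->]].
  rewrite differential_sqdist // -opprB -scaleN1r bilinZl ng //.
  by rewrite !mulr0.
move=> /critical_hook[[/(hook_coneP _ kn)[[z [g [sg pE]]]|sp] _] cp]; last first.
  have [|x [xz xh]] := @normal_inf_surj K n k k1 kn Q (hat p) h Qu sp.
    move=> u su; rewrite hatK; apply: cp; rewrite -[p]hatK; exact: tangent_infinity.
  by case/negP: hi; rewrite -xh FiP.
have ng : normal_at z (h - chart z g).
  by move=> u su; rewrite -/(chart z g) in pE; rewrite -pE; apply: cp; rewrite pE; exact: tangent_chart.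
have [Ez gd _] := param _ _ sg ng.
have rz : (resolvent h).[z] = 0 by apply/resolventP => //; exists g.
apply/mapP; exists z; first by rewrite zsP rz.
have [sg' ng'] := gzP z rz; rewrite pE; congr (chart z _).
apply/eqP; rewrite -subr_eq0; apply/eqP; apply: (normal_inj Ez).
  by apply: leq_trans (size_polyD _ _) _; rewrite geq_max size_polyN sg.
move=> u su.
have -> : chart z (g - gz z) = (h - chart z (gz z)) - (h - chart z g).
  by rewrite /chart mulrBr linearB /= opprB [RHS]addrC subrKA.
by rewrite bilinBl ng // ng' // subrr.
Qed.

End Criterion.

(** * Top coefficients and positive definite real forms *)

Section TopCoefficient.
Variable A : nzRingType.
Implicit Types p q : {poly A}.

(** The coefficient in a degree that bounds the degree of a product is
    multiplicative, even if the bounds on the factors are not sharp. *)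
Lemma size_coef_mul p q a b : (size p <= a.+1)%N -> (size q <= b.+1)%N ->
  (size (p * q)%R <= (a + b).+1)%N /\ (p * q)`_(a + b) = p`_a * q`_b.
Proof.
move=> sp sq; split.
  by apply: leq_trans (size_polyMleq _ _) _; move: sp sq; case: (size p) => [|?] /=; lia.
rewrite coefM (bigD1 (inord a)) //= inordK ?ltnS ?leq_addr // addKn big1 ?addr0 // => i.
rewrite -val_eqE /= inordK ?ltnS ?leq_addr // => ia.
have [h|h] := ltnP a i; first by rewrite nth_default ?mul0r // (leq_trans sp).
rewrite [q`_ _]nth_default ?mulr0 // (leq_trans sq) //; lia.
Qed.

Lemma size_coef_exp p a m : (size p <= a.+1)%N ->
  (size (p ^+ m)%R <= (m * a).+1)%N /\ (p ^+ m)`_(m * a) = p`_a ^+ m.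
Proof.
move=> sp; elim: m => [|m [IH1 IH2]]; first by rewrite mul0n !expr0 size_poly1 coefC.
by rewrite !exprS mulSn; have [? ->] := size_coef_mul sp IH1; rewrite IH2.
Qed.
End TopCoefficient.

Section PositiveDefinite.
Variable R : realType.

Lemma bilin_map (A B : comNzRingType) (f : {rmorphism A -> B}) m (Q : 'M[A]_m) u v :
  bilin (map_mx f Q) (map_mx f u) (map_mx f v) = f (bilin Q u v).
Proof. by rewrite /bilin map_trmx -!map_mxM mxE. Qed.

Lemma posdef_eq0 m (Q : 'M[R]_m) v : posdef Q -> bilin Q v v = 0 -> v = 0.
Proof.
move=> [_ Qp] v0; apply/eqP/negPn/negP => /Qp; rewrite v0 ltxx; by [].
Qed.

Lemma complexify_sym m (Q : 'M[R]_m) : posdef Q -> (complexify Q)^T = complexify Q.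
Proof. by move=> [QT _]; rewrite /complexify map_trmx QT. Qed.

(** A complex subspace defined by real equations, here the vanishing of some
    coordinates, contains the conjugates of its elements, so it meets its orthogonal
    complement trivially.  It is enough to pair [v] with its real and imaginary
    parts. *)
Lemma posdef_nondegenerate m (Q : 'M[R]_m) (P : pred 'I_m) (v : 'rV[R[i]]_m) :
  posdef Q -> (forall i, ~~ P i -> v 0 i = 0) ->
  (forall w : 'rV_m, (forall i, ~~ P i -> w 0 i = 0) -> bilin (complexify Q) v w = 0) ->
  v = 0.
Proof.
move=> Qp v0 vP.
pose a : 'rV[R]_m := map_mx (@complex.Re R) v; pose b : 'rV[R]_m := map_mx (@complex.Im R) v.
pose toC (w : 'rV[R]_m) := map_mx (real_complex R) w.
have vE : v = toC a + 'i%C *: toC b.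
  by apply/rowP => i; rewrite !mxE -complexE.
have bE w : bilin (complexify Q) v (toC w) =
    (bilin Q a w)%:C%C + 'i%C * (bilin Q b w)%:C%C.
  by rewrite vE bilinDl bilinZl !bilin_map.
have a0 i : ~~ P i -> toC a 0 i = 0 by move=> Pi; rewrite !mxE v0.
have b0 i : ~~ P i -> toC b 0 i = 0 by move=> Pi; rewrite !mxE v0.
have /eqP := vP _ a0; rewrite bE eq_complex /= => /andP[/eqP aa _].
have /eqP := vP _ b0; rewrite bE eq_complex /= => /andP[_ /eqP bb].
have {}aa : a = 0.
  by apply: (posdef_eq0 Qp); move: aa; rewrite !mul0r mulr0 subr0 addr0.
have {}bb : b = 0.
  by apply: (posdef_eq0 Qp); move: bb; rewrite !mul0r mul1r !add0r.
by rewrite vE aa bb /toC !map_mx0 scaler0 addr0.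
Qed.

Lemma complexify_unit m (Q : 'M[R]_m) : posdef Q -> complexify Q \in unitmx.
Proof.
move=> Qp; rewrite unitmxE unitfE; apply/det0P => -[v v0 vQ]; case/eqP: v0.
by apply: (posdef_nondegenerate (P := predT) Qp) => // w _; rewrite /bilin vQ mul0mx mxE.
Qed.

Lemma posdef_transverse0 n k (Q : 'M[R]_n.+1) : (1 < k)%N -> (k <= n)%N -> posdef Q ->
  ~ exists g : {poly R[i]}, (size g <= (n - k).+1)%N /\
    normal_at k (complexify Q) 0 (tdir n k 0 1 - chart n k 0 g).
Proof.
move=> k1 kn Qp [g [sg ng]].
have vE : tdir n k 0 1 - chart n k 0 g = tdir n k 0 (1 - 'X * g).
  rewrite /tdir /chart -linearB /= mulrBr subr0 -{1 2}(@prednK k) ?(ltnW k1) //.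
  by rewrite exprSr mulrA.
have s1 : (size (1 - 'X * g)%R <= (n - k).+2)%N.
  apply: leq_trans (size_polyD _ _) _; rewrite geq_max size_polyN size_poly1 /=.
  apply: leq_trans (size_polyMleq _ _) _; rewrite size_polyX; exact: sg.
have : tdir n k 0 1 - chart n k 0 g = 0.
  apply: (posdef_nondegenerate (P := fun i => (k.-1 <= i)%N) Qp).
    move=> i; rewrite -ltnNge vE => ik; rewrite mxE subr0 coefXnM ik mul0r //.
  move=> w w0; have -> : w = tdir n k 0 (drop_poly k.-1 (hat w)).
    apply/rowP => i; rewrite mxE subr0 coefXnM; case: ltnP => ik.
      by rewrite w0 -?ltnNge // mul0r.
    by rewrite coef_drop_poly subnK // coef_hat mulrC mulKf ?binK_neq0.
  by apply: ng; rewrite size_drop_poly; apply: leq_trans (leq_sub2r _ (size_hat w)) _; lia.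
rewrite vE => /(tdir_inj k1 kn s1) /(congr1 (horner^~ 0)).
rewrite -polyC1 !(hornerD, hornerN, hornerM, hornerX, hornerC, horner0) mul0r subr0 => /eqP.
by rewrite oner_eq0.
Qed.

End PositiveDefinite.

(** * The special inner product *)

Section Bipencil.
Variables (A : comNzRingType) (x : A) (a b : nat).
Definition bipencil : {poly A} := (x%:P - 'X) ^+ a * (1 + x%:P * 'X) ^+ b.

Lemma horner_bipencil e : bipencil.[e] = (x - e) ^+ a * (1 + x * e) ^+ b.
Proof. by rewrite /bipencil hornerM !horner_exp !hornerE. Qed.

Lemma size_bipencil : (size bipencil <= (a + b).+1)%N /\ bipencil`_(a + b) = (-1) ^+ a * x ^+ b.
Proof.
have s1 : (size (x%:P - 'X)%R <= 2)%N by rewrite -size_polyN opprB size_XsubC.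
have s2 : (size (1 + x%:P * 'X)%R <= 2)%N.
  apply: leq_trans (size_polyD _ _) _; rewrite geq_max size_poly1 /=.
  by rewrite mul_polyC (leq_trans (size_scale_leq _ _)) ?size_polyX.
have [t1 c1] := size_coef_exp a s1; have [t2 c2] := size_coef_exp b s2.
rewrite !muln1 in t1 c1 t2 c2.
have [t3 c3] := size_coef_mul t1 t2; split => //; rewrite [LHS]c3 c1 c2.
by rewrite coefB coefC coefX sub0r coefD coef1 coefMX coefC /= add0r.
Qed.
End Bipencil.

Section PolarPencil.
Variables (K : numFieldType) (n k : nat).
Hypotheses (k1 : (1 < k)%N) (kn : (k <= n)%N).
Implicit Types (z : K).
Local Notation N := (n - k).+1.

(** The linear form apolar to ['X - z%:P]. *)
Definition polar z : {poly K} := 1 + z *: 'X.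

Lemma coef_polar z t j : (polar z ^+ t)`_j = 'C(t, j)%:R * z ^+ j.
Proof.
rewrite /polar exprDn coef_sum.
have [jt|jt] := leqP j t; last first.
  rewrite bin_small // mul0r big1 // => i _.
  rewrite expr1n mul1r exprZn coefMn coefZ coefXn gtn_eqF ?mulr0 ?mul0rn //.
  by apply: leq_ltn_trans jt; rewrite -ltnS.
rewrite (bigD1 (Ordinal (jt : (j < t.+1)%N))) //= big1 ?addr0.
  by rewrite expr1n mul1r exprZn coefMn coefZ coefXn eqxx mulr1 mulr_natl.
move=> i ij; rewrite expr1n mul1r exprZn coefMn coefZ coefXn.
by rewrite eq_sym (negPf (_ : i != j :> nat)) ?mulr0 ?mul0rn.
Qed.

Lemma size_polarX z t : (size (polar z ^+ t)%R <= t.+1)%N.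
Proof.
apply/leq_sizeP => j tj; rewrite coef_polar bin_small ?mul0r //.
Qed.

Definition special_coef (j : 'I_n.+1) : {poly K} :=
  coef_curve j (bipencil ('X : {poly K}) k.-1 N).

Lemma horner_special_coef z j :
  (special_coef j).[z] = (('X - z%:P) ^+ k.-1 * polar z ^+ N)`_j.
Proof. by rewrite coef_curve_horner horner_bipencil /polar -mul_polyC (mulrC z%:P). Qed.

Lemma size_special_coef j : (size (special_coef j) <= n.+1)%N.
Proof.
apply: leq_trans (size_poly _ _) _; have [s _] := size_bipencil ('X : {poly K}) k.-1 N.
by apply: leq_trans s _; lia.
Qed.

Lemma lead_special_coef j : (special_coef j)`_n = (-1) ^+ k.-1 * (j == N :> nat)%:R.
Proof.
rewrite /special_coef /coef_curve coef_map_id0 ?raddf0 //=.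
have [_] := size_bipencil ('X : {poly K}) k.-1 N; have -> : (k.-1 + N = n)%N by lia.
have -> : (-1) ^+ k.-1 = ((-1) ^+ k.-1)%:P :> {poly K} by rewrite rmorphXn rmorphN1.
by move=> ->; rewrite coefCM coefXn.
Qed.
End PolarPencil.

Section SpecialForm.
Variables (R : realType) (n k : nat).
Hypotheses (k1 : (1 < k)%N) (kn : (k <= n)%N).
Implicit Types (p v h : 'rV[R[i]]_n.+1) (f g u : {poly R[i]}) (z : R[i]).

Local Notation Q := (complexify (special_gram R n)).
Local Notation N := (n - k).+1.
Local Notation chart := (@chart R[i] n k).
Local Notation tdir := (@tdir R[i] n k).

Lemma bilin_special v u : bilin Q v (vec n u) = \sum_j v 0 j * u`_j.
Proof.
rewrite bilin_vec /complexify /special_gram map_diag_mx; apply: eq_bigr => j _.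
by rewrite mul_mx_diag !mxE rmorph_nat mulrA -(mulrA (v 0 j)) (mulrC 'C(n, j)%:R) mulrA mulfK ?binK_neq0.
Qed.

Lemma special_posdef : posdef (special_gram R n).
Proof.
split; first by rewrite /special_gram tr_diag_mx.
move=> v /rV0Pn[i vi]; rewrite bilinE /special_gram mul_mx_diag.
rewrite (bigD1 i) //= !mxE ltr_pwDl //.
  rewrite mulrAC -expr2 mulr_gt0 ?exprn_even_gt0 ?vi //.
  by rewrite ltr0n bin_gt0 -ltnS.
apply: sumr_ge0 => j _; rewrite !mxE mulrAC -expr2 mulr_ge0 ?sqr_ge0 ?ler0n //.
Qed.

Lemma bin_mul_bin (t j : nat) : (t <= j)%N -> (j <= n)%N ->
  ('C(n, j) * 'C(j, t) = 'C(n, t) * 'C(n - t, j - t))%N.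
Proof.
move=> tj jn; have tn := leq_trans tj jn.
apply/eqP; rewrite -(eqn_pmul2r (_ : 0 < (j - t)`! * (t`! * (n - j)`!))%N) ?muln_gt0 ?fact_gt0 //.
apply/eqP.
have e1 := bin_fact jn; have e2 := bin_fact tj; have e3 := bin_fact tn.
have e4 : ('C(n - t, j - t) * ((j - t)`! * (n - j)`!) = (n - t)`!)%N.
  by rewrite -[(n - j)%N](_ : (n - t - (j - t) = n - j)%N) ?bin_fact ?leq_sub2r //; lia.
transitivity (n`!); [rewrite -e1 -e2|rewrite -e3 -e4]; nia.
Qed.

(** For [t = 0] this is the reproducing property of [m ^+ n], which represents the
    evaluation at [z]; the derivatives of [m ^+ n] in [z] represent the derivatives. *)
Lemma bilin_polar f z t : (size f <= n.+1)%N -> (t <= n)%N ->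
  bilin Q (vec n f) (vec n ('X^t * polar z ^+ (n - t))) = f^`N(t).[z] / 'C(n, t)%:R.
Proof.
move=> sf tn; rewrite bilin_special.
have fE : f = \sum_(j < n.+1) f`_j *: 'X^j.
  rewrite -poly_def; apply/polyP => j; rewrite coef_poly; case: ltnP => // jn.
  by rewrite nth_default // (leq_trans sf).
have -> : f^`N(t).[z] = \sum_(j < n.+1) f`_j * ('C(j, t)%:R * z ^+ (j - t)).
  rewrite {1}fE linear_sum horner_sum; apply: eq_bigr => j _.
  by rewrite /= nderivnZ nderivnXn hornerZ hornerMn hornerXn mulr_natl.
rewrite mulr_suml; apply: eq_bigr => j _; rewrite [vec _ _ _ _]mxE coefXnM.
case: (ltnP j t) => jt; first by rewrite [in RHS]bin_small // mul0r !mulr0 mul0r.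
have jn : (j <= n)%N by rewrite -ltnS.
rewrite coef_polar -!mulrA; congr (_ * _).
have := congr1 (fun m : nat => m%:R : R[i]) (bin_mul_bin jt jn); rewrite /= !natrM => e.
have Cj : 'C(n, j)%:R != 0 :> R[i] by rewrite pnatr_eq0 -lt0n bin_gt0.
have Ct : 'C(n, t)%:R != 0 :> R[i] by rewrite pnatr_eq0 -lt0n bin_gt0.
apply: (mulfI Cj); apply: (mulfI Ct); rewrite mulVKf // !mulrA -e; field; exact: Ct.
Qed.

(** The polynomials of degree less than [k] are combinations of the
    ['X^t * m ^+ (k.-1 - t)], because [1 = m - z *: 'X]; so [m ^+ N * u] is a combination
    of the ['X^t * m ^+ (n - t)] with [t < k], which represent derivatives at [z] of
    order less than [k]. *)
Lemma apolar z g u : (size g <= N)%N -> (size u <= k)%N ->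
  bilin Q (chart z g) (vec n (polar z ^+ N * u)) = 0.
Proof.
move=> sg su.
have key t : (t < k)%N -> bilin Q (chart z g) (vec n ('X^t * polar z ^+ (n - t))) = 0.
  move=> tk; rewrite bilin_polar ?nderivn_lexp0 ?mul0r //; first exact: size_chart.
  by lia.
have -> : polar z ^+ N * u = \sum_(i < k) \sum_(s < (k.-1 - i).+1)
    (u`_i * ((- z) ^+ s * 'C(k.-1 - i, s)%:R)) *: ('X^(i + s) * polar z ^+ (n - (i + s))).
  have {1}-> : u = \sum_(i < k) u`_i *: ('X^i * (polar z - z *: 'X) ^+ (k.-1 - i)).
    rewrite (_ : polar z - z *: 'X = 1); last by rewrite /polar addrK.
    rewrite -[LHS]coefK poly_def (big_ord_widen k (fun i => u`_i *: 'X^i)) // big_mkcond /=.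
    apply: eq_bigr => i _; rewrite expr1n mulr1; case: ltnP => // h.
    by rewrite nth_default // scale0r.
  rewrite mulr_sumr; apply: eq_bigr => i _; have ik := ltn_ord i.
  rewrite [(_ - _) ^+ _]exprDn mulr_sumr scaler_sumr mulr_sumr; apply: eq_bigr => s _.
  have sk := ltn_ord s; have -> : (n - (i + s) = N + (k.-1 - i - s))%N by lia.
  rewrite -scaleNr exprZn -!mul_polyC -mulr_natr !polyCM polyC_natr !exprD; ring.
rewrite linear_sum bilin_sumr big1 // => i _; rewrite linear_sum bilin_sumr big1 // => s _.
rewrite linearZ bilinZr key ?mulr0 //; have := ltn_ord i; have := ltn_ord s; lia.
Qed.

(** Bezout's identity for [l ^+ k] and [m ^+ N]: they are coprime because
    [m.[z] = z ^+ 2 + 1]. *)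
Lemma polar_decomposition z f : z ^+ 2 + 1 != 0 -> (size f <= n.+1)%N ->
  exists g u, [/\ (size g <= N)%N, (size u <= k)%N &
    f = ('X - z%:P) ^+ k * g + polar z ^+ N * u].
Proof.
move=> z0 sf; pose L := ('X - z%:P) ^+ k.
have sL : size L = k.+1 by rewrite size_exp_XsubC.
have : coprimep L (polar z ^+ N).
  rewrite coprimep_expl // coprimep_expr // coprimep_sym coprimep_XsubC /root.
  by rewrite /polar !hornerE -expr2 addrC.
move/Bezout_eq1_coprimepP => -[[a b] /= ab].
pose u := (f * b) %% L; pose g := f * a + (f * b) %/ L * polar z ^+ N.
have fE : f = L * g + polar z ^+ N * u.
  rewrite -{1}[f]mulr1 -ab /g mulrDr !mulrA -/L {1}(divp_eq (f * b) L) -/u; ring.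
have su : (size u <= k)%N by rewrite -ltnS -sL ltn_modp monic_neq0 ?monic_exp ?monicXsubC.
exists g, u; split => //; apply: (@geq_size_lexp _ z k).
have -> : ('X - z%:P) ^+ k * g = f - polar z ^+ N * u by rewrite {1}fE addrK.
apply: leq_trans (size_polyD _ _) _; rewrite geq_max size_polyN; apply/andP; split.
  by apply: leq_trans sf _; lia.
have su' : (size u <= k.-1.+1)%N by rewrite prednK // ltnW.
by have [sm _] := size_coef_mul (size_polarX z N) su'; apply: leq_trans sm _; lia.
Qed.

Lemma horner_special_resolvent h z :
  (resolvent (special_coef R[i] k) h).[z] = bilin Q h (tdir z (polar z ^+ N)).
Proof.
rewrite horner_resolvent bilin_special; apply: eq_bigr => j _.
by rewrite horner_special_coef.
Qed.

(** Decomposing [h = l ^+ k * g + m ^+ N * u], the second term is orthogonal to the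
    multiples of [l ^+ k] by [apolar], and these multiples together with
    [l ^+ k.-1 * m ^+ N] span [W_z]. *)
Lemma special_EDdegree_hook : is_EDdegree Q (@hook_cone R[i] n k) n.
Proof.
have Qp := special_posdef; have Qs := complexify_sym Qp.
have z0 z : ('X^2 + 1 : {poly R[i]}).[z] = z ^+ 2 + 1 by rewrite hornerD hornerXn -polyC1 hornerC.
have polar_z z : (polar z).[z] = z ^+ 2 + 1.
  by rewrite /polar !hornerE addrC expr2.
have orth z g : (size g <= N)%N -> bilin Q (chart z g) (tdir z (polar z ^+ N)) = 0.
  move=> sg; rewrite /tdir mulrC apolar // size_exp_XsubC prednK //; exact: ltnW.
apply: (@EDdegree_criterion _ n k k1 kn Q Qs (complexify_unit Qp) ('X^2 + 1) (@special_coef R[i] n k) n).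
- by rewrite z0 expr0n /= add0r oner_neq0.
- move=> z h; rewrite z0 => zn; rewrite horner_special_resolvent; split.
    move=> [g [sg ng]]; rewrite -[h](subrK (chart z g)) bilinDl ng ?add0r ?orth //.
    exact: size_polarX.
  move=> hz; have [g [u [sg su hE]]] := polar_decomposition zn (size_hat h).
  have {}hE : h - chart z g = vec n (polar z ^+ N * u).
    by rewrite -[h]hatK hE linearD /= addrC addKr.
  exists g; split => // w sw; pose e := w.[z] / (polar z ^+ N).[z].
  have [w' w'E] : exists w', w - e *: polar z ^+ N = w' * ('X - z%:P).
    apply/factor_theorem; rewrite rootE hornerD hornerN hornerZ /e divfK ?subrr //.
    by rewrite horner_exp expf_neq0 // polar_z.
  have sw' : (size w' <= N)%N.
    apply: (@geq_size_lexp _ z 1); rewrite expr1 mulrC -w'E.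
    apply: leq_trans (size_polyD _ _) _; rewrite geq_max sw size_polyN.
    exact: leq_trans (size_scale_leq _ _) (size_polarX _ _).
  have -> : w = e *: polar z ^+ N + w' * ('X - z%:P) by rewrite -w'E addrC subrK.
  have -> : tdir z (e *: polar z ^+ N + w' * ('X - z%:P)) =
            e *: tdir z (polar z ^+ N) + chart z w'.
    rewrite tdir_is_linear; congr (_ + _); rewrite /tdir /chart mulrCA mulrC -exprSr.
    by rewrite prednK // ltnW.
  rewrite bilinDr bilinZr {1}bilinBl hz orth // subr0 mulr0 add0r hE.
  by rewrite (bilin_sym _ _ Qs) apolar.
- move=> z _; apply: contrapT => /forallNP H.
  have /eqP : ('X - z%:P) ^+ k.-1 * polar z ^+ N = 0.
    apply: (@vec_inj _ n); rewrite ?size_poly0 ?(size_tdir k1 kn) ?size_polarX //.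
    apply/rowP => j; rewrite linear0 !mxE; have /negP := H j; rewrite negbK => /eqP.
    by rewrite horner_special_coef => ->; rewrite mul0r.
  rewrite mulf_eq0 !expf_eq0 polyXsubC_eq0 andbF /= => /eqP p0.
  have := congr1 (horner^~ 0) p0; rewrite /polar !hornerE => /eqP.
  by rewrite oner_eq0.
- by move=> j; exact: size_special_coef.
- have jn : (N < n.+1)%N by lia.
  exists (Ordinal jn); rewrite lead_special_coef // eqxx mulr1 expf_neq0 //.
  by rewrite oppr_eq0 oner_eq0.
- exact: posdef_transverse0.
- move=> z g; rewrite z0 => zn sg ng.
  have c0 : chart z g = 0.
    apply: (posdef_nondegenerate (P := predT) Qp) => // w _.
    have [g' [u [sg' su wE]]] := polar_decomposition zn (size_hat w).
    rewrite -[w]hatK wE linearD bilinDr /= apolar // addr0.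
    have := ng (('X - z%:P) * g') _; rewrite /tdir mulrA -exprSr prednK ?(ltnW k1) //.
    by apply; rewrite -[_ - _]expr1; apply: (leq_trans (leq_size_lexp _ _ sg')).
  have := c0; rewrite -(linear0 (vec n)) => /vec_inj E.
  have /eqP : ('X - z%:P) ^+ k * g = 0 by apply: E; rewrite ?size_poly0 // size_chart.
  by rewrite mulf_eq0 expf_eq0 polyXsubC_eq0 andbF /= => /eqP.
Qed.

End SpecialForm.

(** * Positive definite forms in general position *)

Section DetDegree.
Variable A : comNzRingType.

Lemma size_coef_prod (I : Type) (r : seq I) (F : I -> {poly A}) (s : I -> nat) :
  (forall i, (size (F i) <= (s i).+1)%N) ->
  (size (\prod_(i <- r) F i)%R <= (\sum_(i <- r) s i).+1)%N /\
  (\prod_(i <- r) F i)`_(\sum_(i <- r) s i) = \prod_(i <- r) (F i)`_(s i).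
Proof.
move=> sF; elim: r => [|i r [IH1 IH2]]; first by rewrite !big_nil size_poly1 coefC.
by rewrite !big_cons; have [? ->] := size_coef_mul (sF i) IH1; rewrite IH2.
Qed.

Lemma size_coef_det d (M : 'M[{poly A}]_d) (s : 'I_d -> nat) :
  (forall i j, (size (M i j) <= (s i).+1)%N) ->
  (size (\det M) <= (\sum_i s i).+1)%N /\
  (\det M)`_(\sum_i s i) = \det (\matrix_(i, j) (M i j)`_(s i)).
Proof.
move=> sM; pose P (t : 'S_d) := size_coef_prod (index_enum 'I_d) (fun i => sM i (t i)).
split.
  apply: leq_trans (size_sum _ _ _) _; apply/bigmax_leqP => t _.
  by rewrite mulr_sign; case: (odd_perm t); rewrite ?size_polyN; exact: (P t).1.
rewrite /determinant coef_sum; apply: eq_bigr => t _; rewrite !mulr_sign.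
have -> : \prod_i (\matrix_(i, j) (M i j)`_(s i)) i (t i) = \prod_i (M i (t i))`_(s i).
  by apply: eq_bigr => i _; rewrite mxE.
by case: (odd_perm t); rewrite ?coefN (P t).2.
Qed.

Lemma size_coef_bilin d (Q : 'M[A]_d) (u w : 'rV[{poly A}]_d) a b :
  (forall i, (size (u 0%R i) <= a.+1)%N) -> (forall i, (size (w 0%R i) <= b.+1)%N) ->
  (size (bilin (map_mx polyC Q) u w) <= (a + b).+1)%N /\
  (bilin (map_mx polyC Q) u w)`_(a + b) =
    bilin Q (\row_i (u 0 i)`_a) (\row_i (w 0 i)`_b).
Proof.
move=> su sw.
have sq j : (size ((u *m map_mx polyC Q) 0 j)%R <= a.+1)%N /\
    ((u *m map_mx polyC Q) 0 j)`_a = ((\row_i (u 0 i)`_a) *m Q) 0 j.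
  rewrite !mxE; split.
    apply: leq_trans (size_sum _ _ _) _; apply/bigmax_leqP => i _.
    by rewrite mxE mulrC mul_polyC (leq_trans (size_scale_leq _ _)).
  by rewrite coef_sum; apply: eq_bigr => i _; rewrite !mxE coefMC.
rewrite !bilinE; split.
  apply: leq_trans (size_sum _ _ _) _; apply/bigmax_leqP => j _.
  exact: (size_coef_mul (sq j).1 (sw j)).1.
rewrite coef_sum; apply: eq_bigr => j _.
by rewrite (size_coef_mul (sq j).1 (sw j)).2 (sq j).2 [X in _ = _ * X]mxE.
Qed.

Definition linpow (x y : A) a : {poly A} := (x%:P - 'X) ^+ a * y%:P.

Lemma horner_linpow x y a e : (linpow x y a).[e] = (x - e) ^+ a * y.
Proof. by rewrite /linpow hornerM horner_exp !hornerE. Qed.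

Lemma size_linpow x y a : (size (linpow x y a) <= a.+1)%N /\
  (linpow x y a)`_a = (-1) ^+ a * y.
Proof.
have s1 : (size (x%:P - 'X)%R <= 2)%N by rewrite -size_polyN opprB size_XsubC.
have [t1 c1] := size_coef_exp a s1; rewrite muln1 in t1 c1.
have [t2 c2] := size_coef_mul t1 (size_polyC_leq1 y).
rewrite addn0 in t2 c2; split => //; rewrite [LHS]c2 c1.
by rewrite coefB coefC coefX sub0r coefC.
Qed.

End DetDegree.

Section GramResolvent.
Variables (K : numClosedFieldType) (n k : nat).
Hypotheses (k1 : (1 < k)%N) (kn : (k <= n)%N).
Implicit Types (p v h : 'rV[K]_n.+1) (g u : {poly K}) (z : K).
Variable Q : 'M[K]_n.+1.

Local Notation N := (n - k).+1.
Local Notation chart := (@chart K n k).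
Local Notation tdir := (@tdir K n k).
Local Notation QP := (map_mx polyC Q).

Lemma normal_atP z v :
  normal_at k Q z v <-> forall j : 'I_N.+1, bilin Q v (tdir z 'X^j) = 0.
Proof.
split=> [nv j|H u su]; first by apply: nv; rewrite size_polyXn.
have -> : u = \sum_(j < N.+1) u`_j *: 'X^j.
  rewrite -poly_def; apply/polyP => j; rewrite coef_poly; case: (ltnP j N.+1) => // jn.
  by rewrite nth_default // (leq_trans su).
rewrite /tdir mulr_sumr linear_sum bilin_sumr big1 // => j _.
by rewrite -scalerAr linearZ bilinZr H mulr0.
Qed.

Definition moving_row a (j : nat) : 'rV[{poly K}]_n.+1 :=
  \row_i ('C(n, i)%:R^-1 *: coef_curve i (linpow 'X ('X^j) a)).

Lemma horner_moving_row a j z :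
  map_mx (horner_eval z) (moving_row a j) = vec n (('X - z%:P) ^+ a * 'X^j).
Proof.
apply/rowP => i; rewrite !mxE /= horner_evalE hornerZ coef_curve_horner horner_linpow.
by rewrite mulrC.
Qed.

Lemma size_moving_row a j i : (size (moving_row a j 0%R i) <= a.+1)%N.
Proof.
rewrite mxE; apply: leq_trans (size_scale_leq _ _) _.
exact: leq_trans (size_poly _ _) (size_linpow _ _ _).1.
Qed.

Lemma top_moving_row a j : \row_i (moving_row a j 0 i)`_a = (-1) ^+ a *: vec n 'X^j.
Proof.
apply/rowP => i; rewrite !mxE coefZ coef_map_id0 ?raddf0 // (size_linpow _ _ _).2 /=.
have -> : (-1) ^+ a = ((-1) ^+ a)%:P :> {poly K} by rewrite rmorphXn rmorphN1.
by rewrite coefCM mulrC mulrA.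
Qed.

Definition gram_row h (i : 'I_N.+1) : 'rV[{poly K}]_n.+1 :=
  if unlift ord0 i is Some i' then moving_row k i' else map_mx polyC h.
(** The matrix of the linear system in [g], bordered by its right hand side [h]. *)
Definition gram_mx h : 'M[{poly K}]_N.+1 :=
  \matrix_(i, j) bilin QP (gram_row h i) (moving_row k.-1 j).
Definition gram_coef (i : 'I_n.+1) : {poly K} := \det (gram_mx (delta_mx 0 i)).

(** Only the first row depends on [h], and it does so linearly. *)
Lemma det_gram_mx h : resolvent gram_coef h = \det (gram_mx h).
Proof.
rewrite (expand_det_row _ ord0); under eq_bigr => j _.
  rewrite mxE /gram_row unlift_none.
  have -> : map_mx polyC h = \sum_i (h 0 i)%:P *: map_mx polyC (delta_mx 0 i).
    rewrite {1}(row_sum_delta h) map_mx_sum; apply: eq_bigr => i _.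
    by rewrite map_mxZ.
  rewrite bilin_suml mulr_suml.
  over.
rewrite exchange_big; apply: eq_bigr => i _; rewrite /gram_coef (expand_det_row _ ord0).
rewrite scaler_sumr; apply: eq_bigr => j _.
rewrite bilinZl -mul_polyC -!mulrA [in LHS]mxE /gram_row unlift_none.
congr (_ * (_ * _)); rewrite /cofactor; congr (_ * \det _).
by apply/matrixP => a b; rewrite !mxE /gram_row liftK.
Qed.

Lemma horner_det_gram h z : (\det (gram_mx h)).[z] =
  \det (\matrix_(i < N.+1, j < N.+1)
     bilin Q (if unlift ord0 i is Some i' then chart z 'X^i' else h) (tdir z 'X^j)).
Proof.
rewrite -horner_evalE -det_map_mx; congr (\det _); apply/matrixP => i j.
rewrite !mxE -[LHS]bilin_map horner_moving_row -map_mx_comp.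
rewrite (_ : map_mx (horner_eval z \o polyC) Q = Q); last first.
  by apply/matrixP => a b; rewrite mxE /= horner_evalE hornerC.
congr (bilin _ _ _); rewrite /gram_row; case: (unlift _ _) => [i'|].
  by rewrite horner_moving_row.
by apply/rowP => b; rewrite !mxE /= horner_evalE hornerC.
Qed.

(** The cofactor [g] read from a row whose first entry is the coefficient of [h]. *)
Definition comb (v : 'rV[K]_N.+1) : {poly K} := \sum_(i < N) v 0 (lift ord0 i) *: 'X^i.

Lemma size_comb (v : 'rV[K]_N.+1) : (size (comb v) <= N)%N.
Proof.
apply: leq_trans (size_sum _ _ _) _; apply/bigmax_leqP => i _.
by rewrite (leq_trans (size_scale_leq _ _)) // size_polyXn.
Qed.

Lemma coef_comb (v : 'rV[K]_N.+1) (i : 'I_N) : (comb v)`_i = v 0 (lift ord0 i).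
Proof.
rewrite coef_sum (bigD1 i) //= coefZ coefXn eqxx mulr1 big1 ?addr0 // => j ji.
by rewrite coefZ coefXn eq_sym (negPf (_ : j != i :> nat)) ?mulr0.
Qed.

Hypothesis Qinj : forall z g, (size g <= N)%N -> normal_at k Q z (chart z g) -> g = 0.

(** A row killed by the bordered matrix is a relation between [h] and the system;
    [Qinj] ensures that the coefficient of [h] is not zero. *)
Lemma gram_resolventP z h :
  (exists g, (size g <= N)%N /\ normal_at k Q z (h - chart z g)) <->
  (resolvent gram_coef h).[z] = 0.
Proof.
rewrite det_gram_mx horner_det_gram; set M := \matrix_(i, j) _.
have vM (v : 'rV[K]_N.+1) j : (v *m M) 0 j = bilin Q (v 0 ord0 *: h + chart z (comb v)) (tdir z 'X^j).
  rewrite mxE big_ord_recl bilinDl bilinZl mxE unlift_none; congr (_ + _).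
  rewrite /chart /comb mulr_sumr linear_sum bilin_suml; apply: eq_bigr => i _.
  by rewrite mxE liftK -scalerAr linearZ bilinZl.
split=> [[g [sg /normal_atP ng]]|/eqP/det0P[v v0 vM0]].
  apply/eqP/det0P.
  exists (\row_i (if unlift ord0 i is Some i' then - g`_i' else 1)).
    by apply/rV0Pn; exists ord0; rewrite mxE unlift_none oner_neq0.
  apply/rowP => j; rewrite vM mxE unlift_none scale1r.
  rewrite (_ : comb _ = - g); last first.
    apply/polyP => i; have [iN|iN] := ltnP i N; last first.
      by rewrite !nth_default ?size_polyN ?(leq_trans _ iN) ?size_comb.
    by rewrite (coef_comb _ (Ordinal iN)) mxE liftK coefN.
  by rewrite /chart mulrN linearN ng mxE.
have ng : normal_at k Q z (v 0 ord0 *: h + chart z (comb v)).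
  by apply/normal_atP => j; rewrite -vM vM0 mxE.
have [h0|h0] := eqVneq (v 0 ord0) 0.
  move: ng; rewrite h0 scale0r add0r => /(Qinj (size_comb v)) c0.
  case/eqP: v0; apply/rowP => i; rewrite [RHS]mxE.
  case: (unliftP ord0 i) => [i' ->|-> //].
  by rewrite -coef_comb c0 coef0.
exists (- (v 0 ord0)^-1 *: comb v); split.
  exact: leq_trans (size_scale_leq _ _) (size_comb v).
move=> u su; apply: (mulfI h0); rewrite mulr0 -bilinZl scalerBr.
rewrite /chart -scalerAr [vec n (_ *: _)]linearZ scalerA mulrN mulfV // scaleN1r opprK.
exact: ng.
Qed.

Definition gram_degree (i : 'I_N.+1) : nat :=
  if unlift ord0 i is Some _ then (k + k.-1)%N else k.-1.

Lemma size_gram_mx h i j : (size (gram_mx h i j) <= (gram_degree i).+1)%N /\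
  (gram_mx h i j)`_(gram_degree i) =
   (if unlift ord0 i is Some _ then (-1) ^+ k * (-1) ^+ k.-1 else (-1) ^+ k.-1) *
   bilin Q (if unlift ord0 i is Some i' then vec n 'X^i' else h) (vec n 'X^j).
Proof.
rewrite mxE /gram_row /gram_degree; case: (unlift ord0 i) => [i'|].
  have [s c] := size_coef_bilin Q (size_moving_row k i') (size_moving_row k.-1 j).
  by split; rewrite ?c ?top_moving_row ?bilinZl ?bilinZr ?mulrA.
have s0 l : (size ((map_mx polyC h : 'rV_n.+1) 0%R l) <= 0.+1)%N.
  by rewrite mxE size_polyC_leq1.
have [s c] := size_coef_bilin Q s0 (size_moving_row k.-1 j).
split => //; rewrite [LHS]c top_moving_row bilinZr; congr (_ * bilin _ _ _).
by apply/rowP => l; rewrite !mxE coefC.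
Qed.

Lemma sum_gram_degree : (\sum_i gram_degree i = (2 * k - 1) * n - 2 * (k - 1) ^ 2)%N.
Proof.
rewrite big_ord_recl /gram_degree unlift_none.
under eq_bigr do rewrite liftK.
rewrite sum_nat_const card_ord.
move: k1 kn => /subnKC <- /subnKC <-; move: (k - 2)%N (n - _)%N => a b.
rewrite addKn; nia.
Qed.

Hypothesis Qinf : forall g, (size g <= N.+1)%N ->
  (forall u, (size u <= N.+1)%N -> bilin Q (vec n g) (vec n u) = 0) -> g = 0.

Local Notation D := (\sum_i gram_degree i)%N.

Lemma size_gram_coef i : (size (gram_coef i) <= D.+1)%N.
Proof.
by apply: (size_coef_det (s := gram_degree) _).1 => a b; exact: (size_gram_mx _ a b).1.
Qed.

(** For the target ['X^N] the leading coefficient of the determinant is, up to sign,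
    the Gram determinant of the polynomials of degree at most [N]: these span the
    limit of [W_z] when [z] tends to infinity. *)
Lemma lead_gram_coef : exists i, (gram_coef i)`_D != 0.
Proof.
apply: contrapT => /forallNP H.
have : (\det (gram_mx (vec n 'X^N)))`_D = 0.
  rewrite -det_gram_mx /resolvent coef_sum big1 // => i _.
  by rewrite coefZ; have /negP := H i; rewrite negbK => /eqP ->; rewrite mulr0.
rewrite (size_coef_det (s := gram_degree) _).2; last by move=> a b; exact: (size_gram_mx _ a b).1.
pose s : 'rV[K]_N.+1 := \row_i
  (if unlift ord0 i is Some _ then (-1) ^+ k * (-1) ^+ k.-1 else (-1) ^+ k.-1).
pose T : 'M[K]_N.+1 := \matrix_(i, j)
   bilin Q (if unlift ord0 i is Some i' then vec n 'X^i' else vec n 'X^N) (vec n 'X^j).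
have TE i j : T i j = bilin Q (if unlift ord0 i is Some i' then vec n 'X^i' else vec n 'X^N)
   (vec n 'X^j) by rewrite mxE.
rewrite (_ : \matrix_(i, j) _ = diag_mx s *m T); last first.
  by apply/matrixP => i j; rewrite mul_diag_mx !mxE -(size_gram_mx _ i j).2 mxE.
rewrite det_mulmx det_diag => /eqP; rewrite mulf_eq0 => /orP[|/det0P[v v0 vT]].
  rewrite prodf_seq_eq0 => /hasP[i _] /=; rewrite mxE.
  by case: unlift => [?|]; rewrite ?mulf_eq0 ?expf_eq0 oppr_eq0 oner_eq0 !andbF.
pose g := v 0 ord0 *: 'X^N + comb v.
have sg : (size g <= N.+1)%N.
  apply: leq_trans (size_polyD _ _) _; rewrite geq_max; apply/andP; split.
    by rewrite (leq_trans (size_scale_leq _ _)) // size_polyXn.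
  exact: leq_trans (size_comb v) _.
have g0 : g = 0.
  apply: Qinf => // u su.
  have -> : u = \sum_(j < N.+1) u`_j *: 'X^j.
    rewrite -poly_def; apply/polyP => j; rewrite coef_poly; case: (ltnP j N.+1) => // jn.
    by rewrite nth_default // (leq_trans su).
  rewrite linear_sum bilin_sumr big1 // => j _; rewrite linearZ bilinZr.
  suff -> : bilin Q (vec n g) (vec n 'X^j) = (v *m T) 0 j by rewrite vT mxE mulr0.
  rewrite [RHS]mxE big_ord_recl /g linearD /= bilinDl linearZ /= bilinZl.
  rewrite TE unlift_none; congr (_ + _).
  rewrite /comb linear_sum bilin_suml; apply: eq_bigr => i _.
  by rewrite TE liftK linearZ /= bilinZl.
case/eqP: v0; apply/rowP => i; rewrite [RHS]mxE.
case: (unliftP ord0 i) => [i' ->|->].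
  have := congr1 (fun p : {poly K} => p`_i') g0; rewrite /g coefD coefZ coefXn coef0 coef_comb.
  by rewrite ltn_eqF // mulr0 add0r.
have := congr1 (fun p : {poly K} => p`_N) g0; rewrite /g coefD coefZ coefXn coef0 eqxx mulr1.
by rewrite [(comb v)`_N]nth_default ?size_comb // addr0.
Qed.

End GramResolvent.

Section PositiveDefiniteDegree.
Variables (R : realType) (n k : nat).
Hypotheses (k1 : (1 < k)%N) (kn : (k <= n)%N).
Variable Q : 'M[R]_n.+1.
Hypothesis Qp : posdef Q.
Local Notation N := (n - k).+1.

Lemma posdef_infinity (g : {poly R[i]}) : (size g <= N.+1)%N ->
  (forall u : {poly R[i]}, (size u <= N.+1)%N -> bilin (complexify Q) (vec n g) (vec n u) = 0) -> g = 0.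
Proof.
move=> sg ng; have Nn : (N.+1 <= n.+1)%N by lia.
have : vec n g = 0.
  apply: (posdef_nondegenerate (P := fun i => (i <= N)%N) Qp).
    by move=> i iN; rewrite mxE nth_default ?mul0r // (leq_trans sg) // ltnNge.
  move=> w w0; rewrite -[w]hatK; apply: ng; apply/size_hatP => // i iN.
  by rewrite w0 // -ltnNge.
by rewrite -(linear0 (vec n)) => /vec_inj; apply; rewrite ?size_poly0 // (leq_trans sg).
Qed.

Lemma posdef_EDdegree_hook :
  (forall z (g : {poly R[i]}), (size g <= N)%N -> normal_at k (complexify Q) z (chart n k z g) -> g = 0) ->
  is_EDdegree (complexify Q) (@hook_cone R[i] n k) ((2 * k - 1) * n - 2 * (k - 1) ^ 2)%N.
Proof.
move=> Qinj; rewrite -(sum_gram_degree k1 kn).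
apply: (@EDdegree_criterion _ n k k1 kn _ (complexify_sym Qp) (complexify_unit Qp) 1
  (gram_coef k (complexify Q))).
- by rewrite -polyC1 hornerC oner_neq0.
- by move=> z h _; exact: gram_resolventP.
- by move=> z; rewrite -polyC1 hornerC => /eqP; rewrite oner_eq0.
- exact: size_gram_coef.
- exact: (lead_gram_coef posdef_infinity).
- exact: posdef_transverse0.
- by move=> z g _; exact: Qinj.
Qed.

End PositiveDefiniteDegree.

(** * Degenerate quadratic forms *)

Section DegenerateForms.
Variables (K : numClosedFieldType) (n k : nat).
Hypotheses (k1 : (1 < k)%N) (kn : (k <= n)%N).
Implicit Types (A M : 'M[K]_n.+1) (y : 'rV[K]_n.+1) (g : {poly K}) (z : K).
Local Notation N := (n - k).+1.
Local Notation chart := (@chart K n k).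

Lemma polyfun_comp r s (f : 'rV[K]_s -> K) (h : 'rV[K]_r -> 'rV[K]_s) :
  polyfun f -> (forall i, polyfun (fun x => h x 0 i)) -> polyfun (fun x => f (h x)).
Proof.
move=> [F FE] hP; apply: (@polyfun_ext _ _ (fun x => F.@[h x 0])).
  by move=> x; rewrite FE.
exact: polyfun_meval.
Qed.

Section FixedDegree.
Variable e : nat.
Hypothesis eN : (e < N)%N.
Let J : 'I_n.+1 := inord (k + e).

Definition stored_point y := chart (zpar y) ('X^e + gpar N y).
Definition stored_normal y := normal_row n k (zpar y) (wpar N y).
Definition solved_row A (l : 'I_n.+1) : K := 'C(n, J)%:R *
  (stored_normal (row J A) 0 l -
   \sum_(i | i != J) stored_point (row J A) 0 i * (A i l + A l i)).
Definition solved_diag A : K := 'C(n, J)%:R *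
  (stored_normal (row J A) 0 J -
   \sum_(i | i != J) stored_point (row J A) 0 i * solved_row A i).
(** The condition that [l ^+ k * g] is orthogonal to [W_z] for the form [M + M^T]
    says that its image is the normal vector given by some [w].  As
    [g] is monic of degree [e], the coordinate [J] of [l ^+ k * g] is a nonzero constant,
    and this linear system can be solved for the row [J] of [M].  The entries
    of this row in [A] are free to store [z], the other coefficients of [g], and [w],
    which are fewer parameters than the length of the row: a degenerate matrix is
    the image under the polynomial map [solved_mx] of a point of a hyperplane. *)
Definition solved_mx A : 'M[K]_n.+1 := \matrix_(i, l)
  if i == J then (if l == J then solved_diag A / 2%:R else solved_row A l - A l J)
  else A i l.

Lemma polyfun_stored_point i : polyfun (fun y => stored_point y 0 i).
Proof.
apply: ppolyfun_vec; apply: ppolyfunM.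
  exact/ppolyfun_XsubC/polyfun_zpar.
by apply: ppolyfunD; [exact: ppolyfunK | exact: ppolyfun_gpar].
Qed.

Lemma polyfun_stored_normal i : polyfun (fun y => stored_normal y 0 i).
Proof.
by apply: polyfun_normal_row => [|t]; [exact: polyfun_zpar | exact: polyfunX].
Qed.

Lemma polyfun_entry i l : polyfun (fun x : 'rV[K]_(n.+1 * n.+1) => vec_mx x i l).
Proof.
apply: (@polyfun_ext _ _ (fun x => x 0 (mxvec_index i l))); last exact: polyfunX.
by move=> x; rewrite mxE.
Qed.

Lemma polyfun_storage i : polyfun (fun x : 'rV[K]_(n.+1 * n.+1) => row J (vec_mx x) 0 i).
Proof.
apply: (@polyfun_ext _ _ (fun x => vec_mx x J i)); last exact: polyfun_entry.
by move=> x; rewrite [RHS]mxE.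
Qed.

Lemma polyfun_solved_row l :
  polyfun (fun x : 'rV[K]_(n.+1 * n.+1) => solved_row (vec_mx x) l).
Proof.
apply: polyfunM; first exact: polyfunC.
apply: polyfunB.
  exact: (polyfun_comp (polyfun_stored_normal l) polyfun_storage).
apply: polyfun_sum => i; apply: polyfunM; last by apply: polyfunD; exact: polyfun_entry.
exact: (polyfun_comp (polyfun_stored_point i) polyfun_storage).
Qed.

Lemma polyfun_solved_diag :
  polyfun (fun x : 'rV[K]_(n.+1 * n.+1) => solved_diag (vec_mx x)).
Proof.
apply: polyfunM; first exact: polyfunC.
apply: polyfunB.
  exact: (polyfun_comp (polyfun_stored_normal J) polyfun_storage).
apply: polyfun_sum => i; apply: polyfunM; last exact: polyfun_solved_row.
exact: (polyfun_comp (polyfun_stored_point i) polyfun_storage).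
Qed.

Lemma polyfun_solved_mx i :
  polyfun (fun x : 'rV[K]_(n.+1 * n.+1) => mxvec (solved_mx (vec_mx x)) 0 i).
Proof.
case: (mxvec_indexP i) => a b.
apply: (@polyfun_ext _ _ (fun x => if a == J then
    (if b == J then solved_diag (vec_mx x) / 2%:R
     else solved_row (vec_mx x) b - vec_mx x b J) else vec_mx x a b)).
  by move=> x; rewrite mxvecE [RHS]mxE.
case: (a == J); last exact: polyfun_entry.
case: (b == J).
  by apply: polyfunM; [exact: polyfun_solved_diag | exact: polyfunC].
by apply: polyfunB; [exact: polyfun_solved_row | exact: polyfun_entry].
Qed.

Lemma J_val : J = (k + e)%N :> nat.
Proof. by rewrite /J inordK; lia. Qed.

Lemma solved_mx_surj M z g : g \is monic -> size g = e.+1 ->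
  normal_at k (M + M^T) z (chart z g) ->
  exists A, A J (inord N) = 0 /\ solved_mx A = M.
Proof.
move=> gm sg /(normal_at_row k1 kn)[w wE].
(* The row [J] stores [g - 'X^e], which leaves its entry of index [N] equal to zero. *)
have sg' : (size (g - 'X^e)%R <= e)%N.
  apply/leq_sizeP => j ej; rewrite coefB coefXn; have [->|je] := eqVneq j e.
    by have /eqP := gm; rewrite lead_coefE sg /= => ->; rewrite subrr.
  by rewrite nth_default ?subrr // sg ltn_neqAle eq_sym je.
pose y := mkpar n N z (g - 'X^e) w.
pose A := \matrix_(i, l) (if i == J then y 0 l else M i l).
have rA : row J A = y by apply/rowP => l; rewrite !mxE eqxx.
have AM i l : i != J -> A i l = M i l by move=> iJ; rewrite mxE (negPf iJ).
have pE : stored_point (row J A) = chart z g.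
  rewrite rA /stored_point zpar_mk gpar_mk ?(leq_trans sg') 1?ltnW //; last by lia.
  by rewrite addrC subrK.
have nE : stored_normal (row J A) = chart z g *m (M + M^T).
  rewrite rA /stored_normal zpar_mk wE; apply/rowP => i; rewrite !mxE; congr (_ * _).
  apply: eq_bigr => t _; rewrite wpar_mk //; have := ltn_ord t; lia.
have pJ : chart z g 0 J = ('C(n, J)%:R)^-1.
  rewrite mxE J_val; have lm : ('X - z%:P) ^+ k * g \is monic.
    by rewrite monicMr ?monic_exp ?monicXsubC.
  have := monicP lm; rewrite lead_coefE size_lexp -size_poly_eq0 sg addnS /= => ->.
  by rewrite mul1r -J_val.
have CJ : 'C(n, J)%:R != 0 :> K by exact: binK_neq0.
have rowE l : l != J -> solved_row A l = (M + M^T) J l.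
  move=> lJ; rewrite /solved_row pE nE [(_ *m _) 0 l]mxE (bigD1 J) //= pJ.
  rewrite (eq_bigr (fun i => chart z g 0 i * (A i l + A l i))).
    by rewrite addrK mulVKf.
  by move=> i iJ; rewrite !AM // [(M + _) _ _]mxE [M^T _ _]mxE.
have diagE : solved_diag A = (M + M^T) J J.
  rewrite /solved_diag pE nE [(_ *m _) 0 J]mxE (bigD1 J) //= pJ.
  rewrite (eq_bigr (fun i => chart z g 0 i * solved_row A i)).
    by rewrite addrK mulVKf.
  move=> i iJ; rewrite rowE //; congr (_ * _).
  by rewrite !mxE addrC.
exists A; split.
  rewrite mxE eqxx mxE inordK ?leqnn /=; last by lia.
  by rewrite nth_default // (leq_trans sg').
apply/matrixP => i l; rewrite mxE; case: eqP => [->|/eqP iJ]; last by rewrite AM.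
case: eqP => [->|/eqP lJ].
  by rewrite diagE !mxE -mulr2n -[_ *+ 2]mulr_natr mulfK ?pnatr_eq0.
by rewrite rowE // AM // !mxE addrK.
Qed.

Lemma degenerate_forms_of_degree : exists F : {mpoly K[n.+1 * n.+1]}, F != 0 /\
  forall M z g, g \is monic -> size g = e.+1 ->
    normal_at k (M + M^T) z (chart z g) -> F.@[mxvec M 0] = 0.
Proof.
have [|F [F0 FP]] := hypersurface_image polyfun_solved_mx (polyfun_entry J (inord N)).
  by exists (const_mx 1); rewrite mxE mxE oner_neq0.
exists F; split => // M z g gm sg ng.
have [A [AJ <-]] := solved_mx_surj gm sg ng.
by have := FP (mxvec A); rewrite mxvecK => ->.
Qed.

End FixedDegree.

(** The zero set of a product contains the degenerate forms for all the degrees of [g],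
    which is made monic by scaling. *)
Lemma degenerate_forms : exists F : {mpoly K[n.+1 * n.+1]}, F != 0 /\
  forall M z g, (size g <= N)%N -> g != 0 ->
    normal_at k (M + M^T) z (chart z g) -> F.@[mxvec M 0] = 0.
Proof.
have /choice[F FP] := fun e : 'I_N => degenerate_forms_of_degree (ltn_ord e).
exists (\prod_e F e); split.
  by apply/prodf_neq0 => e _; exact: (FP e).1.
move=> M z g sg g0 ng; rewrite rmorph_prod; apply/eqP; rewrite prodf_seq_eq0.
have eN : ((size g).-1 < N)%N by rewrite prednK // lt0n size_poly_eq0.
apply/hasP; exists (Ordinal eN); first exact: mem_index_enum.
apply/eqP; apply: ((FP (Ordinal eN)).2 M z ((lead_coef g)^-1 *: g)).
- by rewrite monicE lead_coefZ mulVf // lead_coef_eq0.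
- by rewrite size_scale ?invr_eq0 ?lead_coef_eq0 //= prednK // lt0n size_poly_eq0.
move=> u su; rewrite /chart -scalerAr linearZ /= bilinZl ng ?mulr0 //.
Qed.

End DegenerateForms.

(** * A generic positive definite form *)

Section GenericForm.
Variable R : realType.

Lemma mpoly_real_imaginary s (F : {mpoly R[i][s]}) : exists A B : {mpoly R[s]},
  forall x : 'rV[R]_s, F.@[(map_mx (real_complex R) x) 0] =
    real_complex R (A.@[x 0]) + 'i%C * real_complex R (B.@[x 0]).
Proof.
exists (\sum_(m <- msupp F) complex.Re F@_m *: 'X_[m]).
exists (\sum_(m <- msupp F) complex.Im F@_m *: 'X_[m]).
have ev (c : 'X_{1..s} -> R) x :
    (\sum_(m <- msupp F) c m *: 'X_[m]).@[x] = \sum_(m <- msupp F) c m * \prod_i x i ^+ m i.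
  by rewrite (raddf_sum (meval x)); apply: eq_bigr => m _ /=; rewrite mevalZ mevalX.
move=> x; rewrite mevalE !ev !(rmorph_sum (real_complex R)) mulr_sumr -big_split.
apply: eq_bigr => m _ /=; rewrite !rmorphM /= mulrA -mulrDl -complexE; congr (_ * _).
by rewrite rmorph_prod; apply: eq_bigr => i _; rewrite rmorphXn /= mxE.
Qed.

(** Each [v_i * v_j] is at most [\sum_l v_l ^+ 2] in absolute value. *)
Lemma posdef_shift m (M : 'M[R]_m) (t : R) : M^T = M ->
  \sum_i \sum_j `|M i j| < t -> posdef (M + t%:M).
Proof.
move=> MT Mt; split; first by rewrite linearD /= MT tr_scalar_mx.
move=> v v0; pose S := \sum_i v 0 i ^+ 2.
have vS i : v 0 i ^+ 2 <= S.
  by rewrite /S (bigD1 i) //= lerDl sumr_ge0 // => j _; exact: sqr_ge0.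
have S0 : 0 < S.
  have /rV0Pn[i vi] := v0; apply: lt_le_trans (vS i).
  by rewrite exprn_even_gt0.
have -> : bilin (M + t%:M) v v = bilin M v v + t * S.
  rewrite /bilin mulmxDr mulmxDl mxE; congr (_ + _).
  rewrite mul_mx_scalar -scalemxAl mxE; congr (_ * _); rewrite mxE.
  by apply: eq_bigr => i _; rewrite mxE expr2.
have : - ((\sum_i \sum_j `|M i j|) * S) <= bilin M v v.
  rewrite bilinE exchange_big mulr_suml -sumrN; apply: ler_sum => j _.
  rewrite mxE !mulr_suml -sumrN; apply: ler_sum => i _.
  have h : `|v 0 i * M i j * v 0 j| <= `|M i j| * S.
    rewrite !normrM mulrAC mulrC ler_wpM2l //.
    have := sqr_ge0 (`|v 0 i| - `|v 0 j|); have := vS i; have := vS j.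
    rewrite sqrrB !real_normK ?num_real // => h1 h2 h3; nra.
  by have := ler_norm (- (v 0 i * M i j * v 0 j)); rewrite normrN => h'; lra.
have : 0 < (t - \sum_i \sum_j `|M i j|) * S by rewrite mulr_gt0 // subr_gt0.
lra.
Qed.

Variables (n k : nat).
Hypotheses (k1 : (1 < k)%N) (kn : (k <= n)%N).
Local Notation m := n.+1.

(** [degenerate_forms] gives a polynomial in a matrix [M] that vanishes when [M + M^T]
    is degenerate.  Given a real point [V] where it does not vanish, it is evaluated at
    the matrices with a fixed antisymmetric part, that of [V], which gives a polynomial in
    the symmetric matrix [M + M^T] that does not vanish at [V + V^T].  Then it does not
    vanish either at [V + V^T + t%:M] for some large [t], which is positive definite. *)
Lemma degenerate_forms_real : exists F : {mpoly R[i][m * m]},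
  (forall q : 'rV[R]_(m * m), posdef (vec_mx q) ->
     F.@[(map_mx (real_complex R) q) 0] != 0 ->
     forall z (g : {poly R[i]}), (size g <= (n - k).+1)%N ->
       normal_at k (complexify (vec_mx q)) z (chart n k z g) -> g = 0) /\
  exists q : 'rV[R]_(m * m), posdef (vec_mx q) /\
     F.@[(map_mx (real_complex R) q) 0] != 0.
Proof.
have [F [F0 FP]] := degenerate_forms R[i] k1 kn.
have [v vF] := mpoly_neq0_nat F0.
pose V (S : nzRingType) : 'M[S]_m := vec_mx (\row_i (v i)%:R).
pose asym := mxvec (2%:R^-1 *: (V R[i] - (V R[i])^T)).
(* [r q + (r q)^T] is [q] when [q] is symmetric, and [r] maps [V + V^T] to [V]. *)
pose r (q : 'rV[R[i]]_(m * m)) := 2%:R^-1 *: q + asym.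
have [|G GE] := @polyfun_meval R[i] (m * m) (m * m) (fun q => r q 0) F.
  move=> i; apply: (@polyfun_ext _ _ (fun q => 2%:R^-1 * q 0 i + asym 0 i)).
    by move=> q; rewrite [RHS]mxE [(_ *: q) _ _]mxE.
  by apply: polyfunD; [apply: polyfunM; [exact: polyfunC|exact: polyfunX] | exact: polyfunC].
have two0 : 2%:R != 0 :> R[i] by rewrite pnatr_eq0.
exists G; split.
  move=> q qp Gq z g sg ng; apply/eqP/negPn/negP => g0; case/negP: Gq; apply/eqP.
  rewrite -GE; set q' := map_mx _ q.
  pose M := vec_mx (r q').
  have MT : M + M^T = complexify (vec_mx q).
    have QT i j : complexify (vec_mx q) j i = complexify (vec_mx q) i j.
      by rewrite -[in RHS](complexify_sym qp) [RHS]mxE.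
    have ME i j : M i j = 2%:R^-1 * complexify (vec_mx q) i j +
        2%:R^-1 * (V R[i] i j - V R[i] j i).
      by rewrite /M /r linearD linearZ /= mxvecK !mxE.
    by apply/matrixP => i j; rewrite mxE [M^T _ _]mxE !ME QT; field.
  by rewrite -(FP M z g) ?MT // /M vec_mxK.
(* The values of [G] on the line [V + V^T + t%:M]. *)
pose gam (i : 'I_(m * m)) : {poly R[i]} :=
  ((mxvec (V R[i] + (V R[i])^T)) 0 i)%:P + (mxvec (1%:M : 'M[R[i]]_m)) 0 i *: 'X.
pose P := mmap polyC gam G.
have PE t : P.[t] = G.@[mxvec (V R[i] + (V R[i])^T + t%:M) 0].
  rewrite horner_mmap; apply: meval_eq => i.
  rewrite hornerD hornerC hornerZ hornerX; move: (V R[i] + _) => B.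
  rewrite -[t%:M]scalemx1 linearD linearZ /=.
  by rewrite [RHS]mxE [X in _ = _ + X]mxE mulrC.
have P0 : P.[0] != 0.
  rewrite PE -GE (meval_eq (v2 := fun i => (v i)%:R)) // => i.
  have -> : r (mxvec (V R[i] + (V R[i])^T + 0%:M)) = mxvec (V R[i]).
    rewrite /r /asym -linearZ -linearD; congr mxvec.
    by apply/matrixP => a b; rewrite !mxE mul0rn; field.
  by rewrite /V vec_mxK mxE.
(* Shifting by at least [c] times the identity makes [V + V^T] positive definite. *)
pose c := (\sum_(i < m) \sum_(j < m) (v (mxvec_index i j) + v (mxvec_index j i))).+1%N.
have [t Pt] : exists t : nat, P.[(c + t)%:R] != 0.
  apply: contrapT => /forallNP H.
  have Pc : P \Po ('X + c%:R%:P) = 0.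
    apply: poly_nat_zero => [a b /eqP|a]; first by rewrite eqr_nat => /eqP.
    have /negP := H a; rewrite negbK => /eqP; rewrite horner_comp hornerD hornerX hornerC.
    by rewrite natrD addrC.
  have := congr1 (horner^~ (- c%:R)) Pc; rewrite horner_comp hornerD hornerX hornerC addNr horner0.
  by move=> h; rewrite h eqxx in P0.
pose Q := V R + (V R)^T + ((c + t)%:R)%:M.
exists (mxvec Q); rewrite mxvecK; split.
  apply: posdef_shift; first by rewrite linearD /= trmxK addrC.
  apply: (@lt_le_trans _ _ c%:R); last by rewrite ler_nat leq_addr.
  rewrite /c -natr1 natr_sum; apply: ltr_pwDr; first exact: ltr01.
  apply: ler_sum => i _; rewrite natr_sum; apply: ler_sum => j _.
  by rewrite !mxE natrD ger0_norm // addr_ge0 ?ler0n.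
move: Pt; rewrite PE (meval_eq (v2 := (map_mx (real_complex R) (mxvec Q)) 0)) // => i.
rewrite map_mxvec; congr (mxvec _ 0 i); apply/matrixP => a b.
by rewrite !mxE !rmorphD /= !rmorph_nat rmorphMn /= rmorph_nat.
Qed.

Lemma generic_EDdegree_hook : is_generic_EDdegree (@hook_cone R[i] n k)
    ((2 * k - 1) * n - 2 * (k - 1) ^ 2)%N.
Proof.
have [F [FP [q0 [q0p Fq0]]]] := degenerate_forms_real.
have [A [B AB]] := mpoly_real_imaginary F.
have [C [Cq0 CF]] : exists C : {mpoly R[m * m]}, C.@[q0 0] != 0 /\
    forall q : 'rV[R]_(m * m), C.@[q 0] != 0 -> F.@[(map_mx (real_complex R) q) 0] != 0.
  have ABP (q : 'rV[R]_(m * m)) : F.@[(map_mx (real_complex R) q) 0] = 0 -> A.@[q 0] = 0 /\ B.@[q 0] = 0.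
    rewrite AB => /eqP; rewrite eq_complex /= => /andP[/eqP a0 /eqP b0].
    by move: a0 b0; rewrite !(mul0r, mul1r, mulr0, subr0, addr0, add0r).
  have [A0|A0] := eqVneq A.@[q0 0] 0.
    have [B0|B0] := eqVneq B.@[q0 0] 0.
      by case/negP: Fq0; rewrite AB A0 B0 mulr0 addr0.
    exists B; split => // q Bq; apply: contraNneq Bq => /ABP[_ ->]; by [].
  exists A; split => // q Aq; apply: contraNneq Aq => /ABP[-> _]; by [].
exists C; split; first by exists q0.
move=> q qp Cq; apply: posdef_EDdegree_hook => // z g sg.
by apply: FP => //; exact: CF.
Qed.

End GenericForm.

Theorem theorem5p1 (R : realType) (n a : nat) (ha : (2 <= a)%N) (han : (a <= n)%N) :
  is_EDdegree (complexify (special_gram R n)) (@hook_cone R[i] n a) n /\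
  is_generic_EDdegree (@hook_cone R[i] n a)
    ((2 * a - 1) * n - 2 * (a - 1) ^ 2)%N.
Proof.
by split; [exact: special_EDdegree_hook | exact: generic_EDdegree_hook].
Qed.
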